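(* Let $1\le p<q<\infty$ be such that $r:=3\left(\frac{q}{p}-1\right)\in[1,p]$, let $k\in(0,q)$ and let $\theta=p/q$. Then there exists a positive constant $C$, independent of $f$, such that for every $f\in\mathbb{H}^{1,p}(B_1)$, $$\|f\|_{k,B_1}\le C\,\|(\boldsymbol{\alpha}\cdot\mathbf{p})f\|_{p,B_1}^{\theta}\,\|f\|_{r,B_1}^{1-\theta}.$$
   Context: $B_1$ is the open unit ball in $\mathbb{R}^3$ centred at the origin. Functions are $\mathbb{C}^4$-valued and $|\cdot|$ is the Euclidean norm on $\mathbb{C}^4$. For $0<s<\infty$, $\|f\|_{s,B_1}=\left(\int_{B_1}|f(\mathbf{x})|^s\,d\mathbf{x}\right)^{1/s}$. $\boldsymbol{\alpha}=(\alpha_1,\alpha_2,\alpha_3)$ is the triple of Dirac matrices, $\alpha_j=\begin{pmatrix}0_2&\sigma_j\\ \sigma_j&0_2\end{pmatrix}$, where $0_2$ is the $2\times2$ zero matrix and $\sigma_1=\begin{pmatrix}0&1\\1&0\end{pmatrix}$, $\sigma_2=\begin{pmatrix}0&-i\\ i&0\end{pmatrix}$, $\sigma_3=\begin{pmatrix}1&0\\0&-1\end{pmatrix}$. $\mathbf{p}=-i\nabla$, so $\boldsymbol{\alpha}\cdot\mathbf{p}=-i\sum_{j=1}^3\alpha_j\,\partial/\partial x_j$. The Dirac-Sobolev space $\mathbb{H}^{1,p}(B_1)$, $1\le p<\infty$, is the completion of $[C_0^\infty(B_1)]^4$ with respect to the norm $\|f\|_{1,p;B_1}=\left\{\int_{B_1}\left(|(\boldsymbol{\alpha}\cdot\mathbf{p})f|^p+|f|^p\right)d\mathbf{x}\right\}^{1/p}$.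 *)

(* Defs.v *)
From HB Require Import structures.
From mathcomp Require Import all_boot all_order all_algebra.
From mathcomp Require Import all_classical all_reals all_analysis.
From mathcomp Require Import complex.

Set Implicit Arguments.
Unset Strict Implicit.
Unset Printing Implicit Defensive.

Import Order.TTheory GRing.Theory Num.Theory.
Import numFieldNormedType.Exports.

Local Open Scope classical_set_scope.
Local Open Scope ring_scope.
Local Open Scope complex_scope.

(* R^3 is R * R * R, which carries the product Borel sigma-algebra (for
   integration) and the product normed-module structure (for derivatives).  The
   norm of the latter is the sup norm: same topology and derivatives as the
   Euclidean norm, but the Euclidean ball has to be given by its equation. *)
Definition unit_ball (R : realType) : set (R * R * R) :=
  [set x | x.1.1 ^+ 2 + x.1.2 ^+ 2 + x.2 ^+ 2 < 1].
Arguments unit_ball : clear implicits.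

(* R^3 with its Borel sigma-algebra, the domain of lebesgue3; its carrier is
   convertible to R * R * R. *)
Notation borel3 R :=
  (measurableTypeR R * measurableTypeR R * measurableTypeR R)%type.

Definition lebesgue3 (R : realType) : {measure set (borel3 R) -> \bar R} :=
  ((@lebesgue_measure R \x @lebesgue_measure R) \x @lebesgue_measure R)%E.

Definition basis_vec (R : realType) (j : 'I_3) : R * R * R :=
  ((j == 0)%:R, (j == 1)%:R, (j == 2)%:R).

Definition partial (R : realType) (j : 'I_3) (u : R * R * R -> R)
    (x : R * R * R) : R :=
  'D_(basis_vec R j) u x.

(* foldr gives the mixed partial derivative along the list s of indices. *)
Definition smooth (R : realType) (u : R * R * R -> R) : Prop :=
  forall (s : seq 'I_3) (x : R * R * R),
    differentiable (foldr (@partial R) u s) x.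

Definition re_part (R : realType) (f : R * R * R -> 'cV[R[i]]_4) (a : 'I_4)
  (x : R * R * R) : R := complex.Re (f x a 0).

Definition im_part (R : realType) (f : R * R * R -> 'cV[R[i]]_4) (a : 'I_4)
  (x : R * R * R) : R := complex.Im (f x a 0).

Definition spinor_norm (R : realType) (v : 'cV[R[i]]_4) : R :=
  Num.sqrt (\sum_(a < 4) (complex.Re (v a 0) ^+ 2 + complex.Im (v a 0) ^+ 2)).

Definition spinor_measurable (R : realType)
    (f : R * R * R -> 'cV[R[i]]_4) : Prop :=
  forall a : 'I_4,
    measurable_fun (T := borel3 R) (unit_ball R) (re_part f a) /\
    measurable_fun (T := borel3 R) (unit_ball R) (im_part f a).

(* Elements of [C_0^oo(B_1)]^4, extended by zero outside the ball. *)
Definition test_function (R : realType)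
    (f : R * R * R -> 'cV[R[i]]_4) : Prop :=
  (forall a : 'I_4, smooth (re_part f a) /\ smooth (im_part f a)) /\
  exists K : set (R * R * R),
    [/\ compact K, K `<=` unit_ball R & forall x, ~ K x -> f x = 0].

Definition pauli (R : realType) (j : 'I_3) : 'M[R[i]]_2 :=
  \matrix_(a < 2, b < 2)
    if j == 0 then (a != b)%:R
    else if j == 1 then (if a == b then 0 else if a == 0 then - 'i else 'i)
    else (if a != b then 0 else if a == 0 then 1 else - 1).

Definition dirac_matrix (R : realType) (j : 'I_3) : 'M[R[i]]_4 :=
  block_mx 0 (pauli R j) (pauli R j) 0.

Definition spinor_partial (R : realType) (j : 'I_3)
    (f : R * R * R -> 'cV[R[i]]_4) (x : R * R * R) : 'cV[R[i]]_4 :=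
  \col_(a < 4) (partial j (re_part f a) x +i* partial j (im_part f a) x).

(* alpha . p acting on classically differentiable functions *)
Definition dirac_op (R : realType) (f : R * R * R -> 'cV[R[i]]_4)
    (x : R * R * R) : 'cV[R[i]]_4 :=
  - 'i *: \sum_(j < 3) dirac_matrix R j *m spinor_partial j f x.

(* || f ||_{s, B_1}, with values in [0, +oo] *)
Definition ball_norm (R : realType) (s : R)
    (f : R * R * R -> 'cV[R[i]]_4) : \bar R :=
  ((\int[lebesgue3 R]_(x in unit_ball R) (spinor_norm (f x) `^ s)%:E) `^ s^-1)%E.

(* The norm || f ||_{1, p; B_1}, where g stands for (alpha . p) f. *)
Definition graph_norm (R : realType) (p : R)
    (f g : R * R * R -> 'cV[R[i]]_4) : \bar R :=
  ((\int[lebesgue3 R]_(x in unit_ball R)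
      (spinor_norm (g x) `^ p + spinor_norm (f x) `^ p)%:E) `^ p^-1)%E.

(* [dirac_sobolev p f g] : f belongs to H^{1,p}(B_1) and (alpha . p) f = g.
   Since L^p(B_1) is complete, completing the test functions for || . ||_{1,p}
   amounts to closing {(phi, (alpha . p) phi)} in L^p x L^p, and alpha . p
   extends to the completion by continuity.  As alpha . p is closable, f
   determines g almost everywhere.  Elements of the completion are classes
   modulo a.e. equality, so f and g range over Borel representatives, of which
   only the values on the ball matter. *)
Definition dirac_sobolev (R : realType) (p : R)
    (f g : R * R * R -> 'cV[R[i]]_4) : Prop :=
  [/\ spinor_measurable f, spinor_measurable g &
   exists phi : nat -> R * R * R -> 'cV[R[i]]_4,
     (forall n, test_function (phi n)) /\
     graph_norm p (fun x => phi n x - f x) (fun x => dirac_op (phi n) x - g x)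
       @[n --> \oo] --> 0%E].

(* Main.v *)
(* The inequality is an interpolation of level-set estimates.

   Each half [psi] of a test function [phi] solves [sigma . grad psi = F], and
   by symmetry it suffices to estimate [Re psi_1].  Testing the equation against
   the regularized fundamental solution [(y - x) (|y - x|^2 + e^2)^(-3/2)], cut
   off at distance [rho], and letting [e] be small bounds [Re psi_1] at [x] by its
   mean over the [rho]-cube around [x] plus
     [int_{|y-x|<rho} |y - x|^-2 |(alpha . p) phi|].
   If [rho^3 lam^r] is comparable with [||phi||_r^r], the mean is negligible where
   [|phi| > lam]; the remaining kernel has mass [O(rho)] in either variable, so
   by Jensen and Fubini
     [|{|phi| > lam}| <= C (rho ||(alpha . p) phi||_p / lam)^p].
   Because [r p / 3 = q - p], the right-hand side is [C (L / lam)^q] with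
   [L = ||(alpha . p) phi||_p^theta ||phi||_r^(1 - theta)].  This passes to the
   closure, and summing over dyadic levels bounds [||f||_k] by [L] for [k < q].  *)
Require Import Defs.
From HB Require Import structures.
From mathcomp Require Import all_boot all_order all_algebra.
From mathcomp Require Import all_classical all_reals all_analysis.
From mathcomp Require Import measurable_realfun.
From mathcomp Require Import complex.
From mathcomp Require Import ring lra.

Set Implicit Arguments.
Unset Strict Implicit.
Unset Printing Implicit Defensive.

Import Order.TTheory GRing.Theory Num.Theory.
Import numFieldNormedType.Exports.
Local Open Scope classical_set_scope.
Local Open Scope ring_scope.

(** * Integration by parts on R^3 *)

Section lebesgue_product.
Local Open Scope ereal_scope.

(** Test functions are extended by zero to the whole space, so no integration by parts has a
    boundary term. No limit of singular integrals is taken either: the regularization [e] is fixed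
    separately at each point [x], so small (by continuity at [x] and integrability of the component)
    that it disappears from the resulting inequality. Working with level sets lets the truncation
    radius depend on the level; this is what turns the sum of a mean term and a drift term into a
    product of two norms. The result is only a weak-type bound at exponent [q], which gives true
    norms for [k < q] because the ball has finite measure. In the passage to the closure,
    convergence is known only in [L^p]. The hypothesis [r <= p] converts it into convergence of the
    [r]-th moments on the ball. The bounds carried along are not the norms themselves but numbers
    [al] and [be] strictly above them: the margins absorb the approximation errors, and they stay
    positive when a norm vanishes. *)

Lemma sigma_finite_product d1 d2 (T1 : measurableType d1)
    (T2 : measurableType d2) (R : realType)
    (m1 : {sigma_finite_measure set T1 -> \bar R})
    (m2 : {sigma_finite_measure set T2 -> \bar R}) :
  sigma_finite setT (m1 \x m2).
Proof.
have /sigma_finiteP[F [FT Fnd Foo]] := sigma_finiteT m1.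
have /sigma_finiteP[G [GT Gnd Goo]] := sigma_finiteT m2.
exists (fun n => F n `*` G n) => [|n]; last first.
  have [mF Fy] := Foo n; have [mG Gy] := Goo n.
  split; first exact: measurableX.
  by rewrite product_measure1E// lte_mul_pinfty// ge0_fin_numE.
apply/esym/seteqP; split => // -[x y] _.
have [i _ Fix] : (\bigcup_i F i) x by rewrite -FT.
have [j _ Gjy] : (\bigcup_j G j) y by rewrite -GT.
exists (maxn i j) => //; split => /=.
- by move: x Fix; apply/subsetPset/Fnd/leq_maxl.
- by move: y Gjy; apply/subsetPset/Gnd/leq_maxr.
Qed.

Variable R : realType.
Local Notation leb := (@lebesgue_measure R).

Definition lebesgue2 :
  set (measurableTypeR R * measurableTypeR R)%type -> \bar R := leb \x leb.
HB.instance Definition _ := Measure.copy lebesgue2 (leb \x leb).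

Lemma sigma_finite_lebesgue2 : sigma_finite setT lebesgue2.
Proof. exact: (@sigma_finite_product _ _ _ _ R leb leb). Qed.

HB.instance Definition _ :=
  @Measure_isSigmaFinite.Build _ _ _ lebesgue2 sigma_finite_lebesgue2.

(* [lebesgue3] is a packed measure, which cannot carry a further instance. *)
Definition leb3 : set (borel3 R) -> \bar R := lebesgue3 R.
HB.instance Definition _ := Measure.copy leb3 (lebesgue3 R).

Lemma sigma_finite_leb3 : sigma_finite setT leb3.
Proof. exact: (@sigma_finite_product _ _ _ _ R lebesgue2 leb). Qed.

HB.instance Definition _ :=
  @Measure_isSigmaFinite.Build _ _ _ leb3 sigma_finite_leb3.

End lebesgue_product.
Arguments leb3 : clear implicits.
Arguments lebesgue2 : clear implicits.

(** * Boxes, open sets and continuous functions against the product Borel structure *)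

Section continuous3.
Variable R : realType.
Implicit Types (u v D : R * R * R -> R).

Definition box (c : R * R * R) (d : R) : set (R * R * R) :=
  [set y | `|y.1.1 - c.1.1| < d /\ `|y.1.2 - c.1.2| < d /\ `|y.2 - c.2| < d].

Lemma box_setX (c : R * R * R) (d : R) :
  box c d = `]c.1.1 - d, c.1.1 + d[%classic `*` `]c.1.2 - d, c.1.2 + d[%classic
            `*` `]c.2 - d, c.2 + d[%classic.
Proof.
apply/seteqP; split => y; rewrite /box/= !in_itv/= !ltr_distl.
  by move=> [-> [-> ->]].
by move=> [[-> ->] ->].
Qed.

Lemma measurable_box (c : R * R * R) (d : R) :
  measurable (box c d : set (borel3 R)).
Proof.
by rewrite box_setX; apply: measurableX => //; apply: measurableX.
Qed.

Lemma leb3_box (c : R * R * R) (d : R) : 0 < d ->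
  leb3 R (box c d) = ((2 * d) ^+ 3)%:E.
Proof.
move=> d0; rewrite box_setX.
rewrite [LHS](@product_measure1E _ _ _ _ R (lebesgue2 R) lebesgue_measure)//;
  last exact: measurableX.
rewrite [X in (X * _)%E](@product_measure1E _ _ _ _ R lebesgue_measure
  lebesgue_measure)//=.
rewrite !lebesgue_measure_itv/= !lte_fin !ltrBlDr -!addrA !ltrDl addr_gt0//.
by rewrite -!EFinB -!EFinM; congr EFin; ring.
Qed.

Lemma ball3E (c : R * R * R) (d : R) : ball c d = box c d.
Proof.
apply/seteqP; split => y; rewrite /ball/=.
  by move=> [[]]; rewrite /ball/= => h1 h2 h3; rewrite /box/= distrC h1 distrC h2 distrC h3.
by move=> [h1 [h2 h3]]; split; [split|]; rewrite /ball/= distrC.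
Qed.

(** The sigma-algebra is the product one and is not given by the topology of the product. An open
    set is the union of the boxes with rational centre and radius [1/(n+1)] that it contains, a
    countable family. *)
Lemma measurable_open3 (U : set (R * R * R)) : open U ->
  measurable (U : set (borel3 R)).
Proof.
move=> oU.
pose F (i : rat * rat * rat * nat) : set (R * R * R) :=
  let c := (ratr i.1.1.1, ratr i.1.1.2, ratr i.1.2) : R * R * R in
  if `[< box c i.2.+1%:R^-1 `<=` U >] then box c i.2.+1%:R^-1 else set0.
suff -> : U = \bigcup_i F i.
  apply: countable_bigcupT_measurable => [|i]; first exact: countableP.
  by rewrite /F; case: ifP => _; [exact: measurable_box|exact: measurable0].
apply/seteqP; split => [x Ux|x [i _]]; last first.
  by rewrite /F; case: ifPn => [/asboolP h /h|].
have /nbhs_ballP[e /= e0 eU] : nbhs x U by exact: open_nbhs_nbhs.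
rewrite ball3E in eU.
have [n ne] : exists n : nat, n.+1%:R^-1 < e / 2.
  have /ltr_add_invr[n] : 0 < e / 2 by rewrite divr_gt0.
  by rewrite add0r => ?; exists n.
have approx (t : R) : exists q : rat, `|t - ratr q| < n.+1%:R^-1.
  have [q] : exists q : rat, ratr q \in `]t, t + n.+1%:R^-1[.
    by apply: rat_in_itvoo; rewrite ltrDl invr_gt0.
  rewrite in_itv/= => /andP[q1 q2]; exists q.
  by rewrite distrC ger0_norm ?subr_ge0 ?ltW// ltrBlDl.
have [q1 h1] := approx x.1.1.
have [q2 h2] := approx x.1.2.
have [q3 h3] := approx x.2.
exists (q1, q2, q3, n) => //; rewrite /F/=.
case: ifPn => [_|/asboolP]; first by split => //.
case => y [/= k1 [k2 k3]]; apply: eU.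
have H (a b c : R) : `|a - c| < n.+1%:R^-1 -> `|b - c| < n.+1%:R^-1 -> `|a - b| < e.
  move=> ac bc; rewrite (le_lt_trans (ler_distD c _ _))// (splitr e) ltrD//.
    exact: lt_trans ne.
  by rewrite distrC (lt_trans _ ne).
by split; [|split]; [exact: (H _ _ _ k1 h1)|exact: (H _ _ _ k2 h2)|exact: (H _ _ _ k3 h3)].
Qed.

Lemma continuous3_measurable_fun u : continuous u ->
  measurable_fun (setT : set (borel3 R)) (u : borel3 R -> R).
Proof.
move=> /continuousP cu; 
apply: (measurability _ (measurable_realfun.RGenOpens.measurableE R)).
move=> _ [_ [a [b ->] <-]]; rewrite setTI.
by apply: measurable_open3; apply: cu; exact: interval_open.
Qed.

End continuous3.

(** * Partial derivatives of functions supported in the ball integrate to zero *)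

Section divergence.
Variable R : realType.
Implicit Types (u v D : R * R * R -> R).

Lemma unit_ball_box (x : R * R * R) : unit_ball R x -> box 0 1 x.
Proof.
rewrite /unit_ball/= => h.
suff H (a b c : R) : a ^+ 2 + b ^+ 2 + c ^+ 2 < 1 -> `|a| < 1.
  rewrite /box/= !subr0; split; first exact: H h.
  split; first by apply: (H _ x.1.1 x.2); rewrite (addrC (x.1.2 ^+ 2)).
  by apply: (H _ x.1.1 x.1.2); rewrite -addrA addrC.
move=> h'; rewrite -(@ltr_pXn2r _ 2)// ?nnegrE// real_normK ?num_real// expr1n.
by rewrite (le_lt_trans _ h')// -addrA lerDl addr_ge0 ?sqr_ge0.
Qed.

Lemma continuous_ball_bounded D : continuous D ->
  (forall x, ~ unit_ball R x -> D x = 0) ->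
  exists2 C, 0 < C & forall x, `|D x| <= C.
Proof.
move=> cD D0.
pose K : set (R * R * R) := `[-1, 1]%classic `*` `[-1, 1]%classic `*` `[-1, 1]%classic.
have cK : compact K by do 2 (apply: compact_setX; last exact: segment_compact); exact: segment_compact.
have K0 : K !=set0 by exists (0, 0, 0); rewrite /K/= !in_itv/= lerN10 ler01.
have cnD : {within K, continuous (fun x => `|D x|)}.
  apply: continuous_subspaceT => x.
  by apply: continuous_comp; [exact: cD|exact: norm_continuous].
have [c _ cmax] := compact_EVT_max K0 cK cnD.
exists (`|D c| + 1); first by rewrite ltr_wpDl.
move=> x; have [bx|/D0 ->] := pselect (unit_ball R x); last first.
  by rewrite normr0 addr_ge0.
rewrite (@le_trans _ _ `|D c|) ?lerDl//; apply: cmax; rewrite inE.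
have [h1 [h2 h3]] := unit_ball_box bx; rewrite /= !subr0 in h1 h2 h3.
rewrite /K/= !in_itv/= -!ler_norml !ltW//.
Qed.

Lemma continuous_ball_integrable D : continuous D ->
  (forall x, ~ unit_ball R x -> D x = 0) ->
  (leb3 R).-integrable setT (EFin \o D).
Proof.
move=> cD D0; have [C C0 DC] := continuous_ball_bounded cD D0.
have mb : measurable (box 0 1 : set (borel3 R)) by exact: measurable_box.
have mD : measurable_fun (setT : set (borel3 R)) D.
  exact: continuous3_measurable_fun.
apply/integrableP; split; first exact/measurable_EFinP.
apply: (@le_lt_trans _ _ (\int[leb3 R]_x (C * \1_(box 0 1) x)%:E)%E).
  apply: ge0_le_integral => //.
  - by apply: measurableT_comp => //; exact/measurable_EFinP.
  - apply/measurable_EFinP; apply: measurable_funM => //.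
  - move=> x _; rewrite /= lee_fin.
    have [bx|/D0 ->] := pselect (unit_ball R x); last first.
      by rewrite normr0 mulr_ge0// ltW.
    by rewrite indicE mem_set ?mulr1//; exact: unit_ball_box.
rewrite (@integralZl_indic _ _ R (leb3 R) setT measurableT (fun=> box 0 1))//; last first.
  by rewrite ltNge ltW.
by rewrite integral_indic// setIT -[X in (_ * X)%E]/(leb3 R (box 0 1)) leb3_box// -EFinM ltry.
Qed.

Lemma integral_derive0 (w w' : R -> R) (M : R) : 0 < M ->
  continuous w' -> (forall t : R, is_derive t 1 w (w' t)) ->
  (forall t, M <= `|t| -> w t = 0) -> (forall t, M <= `|t| -> w' t = 0) ->
  (\int[lebesgue_measure]_t (w' t)%:E = 0)%E.
Proof.
move=> M0 cw' dw w0 w'0.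
have -> : (fun t => (w' t)%:E) = (EFin \o w') \_ `[- M, M].
  apply/funext => t; rewrite patchE; case: ifPn => //.
  rewrite notin_setE/= in_itv/= -ler_norml => /negP; rewrite -ltNge => /ltW.
  by move=> /w'0 ->.
rewrite -integral_mkcond.
rewrite (@continuous_FTC2 _ w' w)//.
- by rewrite !w0 ?subee// ?normrN gtr0_norm.
- by rewrite gtrN.
- exact: continuous_subspaceT.
- have cw : continuous w.
    move=> t; apply: differentiable_continuous.
    by apply/derivable1_diffP; exact: ex_derive.
  split.
  + by move=> t _; exact: ex_derive.
  + by apply: cvg_at_right_filter; exact: cw.
  + by apply: cvg_at_left_filter; exact: cw.
- by move=> t _; rewrite derive1E; exact: derive_val.
Qed.

(** Turns directional derivatives into derivatives of one real variable, where the chain rule is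
    applied. *)
Lemma is_derive_line v (y e : R * R * R) (D : R) :
  is_derive y e v D <-> is_derive (0 : R) 1 (fun t => v (t *: e + y)) D.
Proof.
have E : (fun h : R => h^-1 *: (v (h *: e + y) - v y)) =
   (fun h : R => h^-1 *: (v ((h *: 1 + 0) *: e + y) - v (0 *: e + y))).
  by apply/funext => h; rewrite addr0 scale0r add0r [h *: 1]mulr1.
by split => -[h1 h2]; split; move: h1 h2; rewrite /derivable /derive/= E.
Qed.


Lemma continuous_slice1 D (a b : R) : continuous D ->
  continuous (fun t : R => D (t, a, b)).
Proof.
move=> cD t; apply: (@continuous_comp _ _ _ (fun t : R => (t, a, b)) D); last exact: cD.
exact: (cvg_pair (cvg_pair cvg_id (cvg_cst _)) (cvg_cst _)).
Qed.

Lemma continuous_slice2 D (a b : R) : continuous D ->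
  continuous (fun t : R => D (a, t, b)).
Proof.
move=> cD t; apply: (@continuous_comp _ _ _ (fun t : R => (a, t, b)) D); last exact: cD.
exact: (cvg_pair (cvg_pair (cvg_cst _) cvg_id) (cvg_cst _)).
Qed.

Lemma continuous_slice3 D (a : R * R) : continuous D ->
  continuous (fun t : R => D (a, t)).
Proof.
move=> cD t; apply: (@continuous_comp _ _ _ (fun t : R => (a, t)) D); last exact: cD.
exact: (cvg_pair (cvg_cst _) cvg_id).
Qed.

Lemma is_derive_coord1 v (t a b D : R) :
  is_derive (t, a, b) (basis_vec R 0) v D -> is_derive t 1 (fun s => v (s, a, b)) D.
Proof.
have E : (fun h : R => h^-1 *: (v (h *: basis_vec R 0 + (t, a, b)) - v (t, a, b))) =
         (fun h : R => h^-1 *: (v (h *: 1 + t, a, b) - v (t, a, b))).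
  apply/funext => h; congr (_ *: (v _ - _)); rewrite /basis_vec/=.
  by congr (_, _, _); rewrite /= ?scaler0 ?add0r.
by move=> -[h1 h2]; split; move: h1 h2; rewrite /derivable /derive/= E.
Qed.

Lemma is_derive_coord2 v (t a b D : R) :
  is_derive (a, t, b) (basis_vec R 1) v D -> is_derive t 1 (fun s => v (a, s, b)) D.
Proof.
have E : (fun h : R => h^-1 *: (v (h *: basis_vec R 1 + (a, t, b)) - v (a, t, b))) =
         (fun h : R => h^-1 *: (v (a, h *: 1 + t, b) - v (a, t, b))).
  apply/funext => h; congr (_ *: (v _ - _)); rewrite /basis_vec/=.
  by congr (_, _, _); rewrite /= ?scaler0 ?add0r.
by move=> -[h1 h2]; split; move: h1 h2; rewrite /derivable /derive/= E.
Qed.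

Lemma is_derive_coord3 v (a : R * R) (t D : R) :
  is_derive (a, t) (basis_vec R 2) v D -> is_derive t 1 (fun s => v (a, s)) D.
Proof.
have E : (fun h : R => h^-1 *: (v (h *: basis_vec R 2 + (a, t)) - v (a, t))) =
         (fun h : R => h^-1 *: (v (a, h *: 1 + t) - v (a, t))).
  apply/funext => h; congr (_ *: (v _ - _)); rewrite /basis_vec/=; case: a => a b.
  by congr (_, _, _); rewrite /= ?scaler0 ?add0r.
by move=> -[h1 h2]; split; move: h1 h2; rewrite /derivable /derive/= E.
Qed.

(** Fubini with the [j]-th axis innermost: on each line parallel to it, the fundamental theorem of
    calculus gives zero because [v] vanishes at both ends. The product measure is nested to the
    left, so the first two axes need a second Fubini inside a plane slice. *)
Lemma integral_partial0 (j : 'I_3) v D : continuous D ->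
  (forall x, ~ unit_ball R x -> v x = 0) ->
  (forall x, ~ unit_ball R x -> D x = 0) ->
  (forall x, is_derive x (basis_vec R j) v (D x)) ->
  (\int[leb3 R]_x (D x)%:E = 0)%E.
Proof.
move=> cD v0 D0 dv.
have iD := continuous_ball_integrable cD D0.
have nb (x : R * R * R) : 1 <= `|x.1.1| \/ 1 <= `|x.1.2| \/ 1 <= `|x.2| -> ~ unit_ball R x.
  move=> h /unit_ball_box []; rewrite /= !subr0 => h1 [h2 h3].
  by case: h => [|[]]; rewrite leNgt ?h1 ?h2 ?h3.

have cst0 : (\int[@lebesgue_measure R]_x (cst 0 x) = 0 :> \bar R)%E by rewrite integral0.
have line (w w' : R -> R) : continuous w' -> (forall t : R, is_derive t 1 w (w' t)) ->
    (forall t, 1 <= `|t| -> w t = 0) -> (forall t, 1 <= `|t| -> w' t = 0) ->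
    (\int[lebesgue_measure]_t (w' t)%:E = 0)%E.
  by move=> *; exact: (integral_derive0 ltr01).
have iD' : (lebesgue2 R \x lebesgue_measure)%E.-integrable setT (EFin \o D) by exact: iD.
case: j dv => -[|[|[|//]]] j3 dv.
- have line1 (y2 y3 : R) : (\int[lebesgue_measure]_t (D (t, y2, y3))%:E = 0)%E.
    apply: (line (fun t => v (t, y2, y3))) => [|t|t ht|t ht].
    + exact: continuous_slice1.
    + by apply: is_derive_coord1; rewrite -[0](_ : Ordinal j3 = 0)//; exact/val_inj.
    + by apply: v0; apply: nb; left.
    + by apply: D0; apply: nb; left.
  rewrite -[LHS](integral21_prod_meas1 iD').
  rewrite -[RHS]cst0; apply: ae_eq_integral => //.
    exact: measurable_fubini_G iD'.
  (* The inner Fubini needs an integrable slice, which is available for almost every [y3] only;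
     hence the almost-everywhere comparison with zero. *)
  apply: filterS (ae_integrable2 iD') => y3 /= iy _.
  rewrite /fubini_G -[LHS](integral21_prod_meas1 iy) integral0_eq// => y2 _.
  exact: line1.
- have line2 (y1 y3 : R) : (\int[lebesgue_measure]_t (D (y1, t, y3))%:E = 0)%E.
    apply: (line (fun t => v (y1, t, y3))) => [|t|t ht|t ht].
    + exact: continuous_slice2.
    + by apply: is_derive_coord2; rewrite -[1](_ : Ordinal j3 = 1)//; exact/val_inj.
    + by apply: v0; apply: nb; right; left.
    + by apply: D0; apply: nb; right; left.
  rewrite -[LHS](integral21_prod_meas1 iD').
  rewrite -[RHS]cst0; apply: ae_eq_integral => //.
    exact: measurable_fubini_G iD'.
  apply: filterS (ae_integrable2 iD') => y3 /= iy _.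
  rewrite /fubini_G -[LHS](integral12_prod_meas1 iy) integral0_eq// => y1 _.
  exact: line2.
- have line3 (y : R * R) : (\int[lebesgue_measure]_t (D (y, t))%:E = 0)%E.
    apply: (line (fun t => v (y, t))) => [|t|t ht|t ht].
    + exact: continuous_slice3.
    + by apply: is_derive_coord3; rewrite -[2](_ : Ordinal j3 = 2)//; exact/val_inj.
    + by apply: v0; apply: nb; right; right.
    + by apply: D0; apply: nb; right; right.
  rewrite -[LHS](integral12_prod_meas1 iD') integral0_eq// => y _.
  exact: line3.
Qed.
End divergence.

(** * Inequalities modulo functions of vanishing integral *)

Section null_integrals.
Local Open Scope ereal_scope.
Context d (T : measurableType d) (R : realType).
Variable mu : {measure set T -> \bar R}.

(** Integrability is kept together with the value, since the value alone does not pass to sums and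
    differences. *)
Definition null_integral (X : T -> R) :=
  mu.-integrable setT (EFin \o X) /\ \int[mu]_x (X x)%:E = 0.

Lemma null_integralD X Y : null_integral X -> null_integral Y ->
  null_integral (fun x => X x + Y x)%R.
Proof.
move=> [iX X0] [iY Y0]; split; first exact: (integrableD measurableT iX iY).
under eq_integral do rewrite EFinD.
by rewrite (integralD measurableT iX iY) X0 Y0 adde0.
Qed.

Lemma null_integralB X Y : null_integral X -> null_integral Y ->
  null_integral (fun x => X x - Y x)%R.
Proof.
move=> [iX X0] [iY Y0]; split; first exact: (integrableB measurableT iX iY).
under eq_integral do rewrite EFinB.
by rewrite (integralB measurableT iX iY) X0 Y0 sube0.
Qed.

(** Pointwise [P + X^- <= B + X^+], and the two parts of [X] have the same finite integral, which
    cancels. Rearranging into nonnegative functions allows [B] to have infinite integral. *)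
Lemma le_integral_null (P B : T -> \bar R) (X : T -> R) :
  measurable_fun setT P -> measurable_fun setT B ->
  (forall x, 0 <= P x) -> (forall x, 0 <= B x) -> null_integral X ->
  (forall x, P x <= (X x)%:E + B x) -> \int[mu]_x P x <= \int[mu]_x B x.
Proof.
move=> mP mB P0 B0 [iX X0] PXB.
pose f := EFin \o X.
have mf : measurable_fun setT f by exact: measurable_int iX.
have mp : measurable_fun setT f^\+ by exact: measurable_funepos.
have mn : measurable_fun setT f^\- by exact: measurable_funeneg.
have fp : \int[mu]_x f^\+ x \is a fin_num by exact: integrable_pos_fin_num.
have fn : \int[mu]_x f^\- x \is a fin_num by exact: integrable_neg_fin_num.
have E : \int[mu]_x f^\+ x = \int[mu]_x f^\- x.
  move: X0 fp fn; rewrite integralE.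
  move: (\int[mu]_x f^\+ x) (\int[mu]_x f^\- x) => [a| |] [b| |]// [/eqP].
  by rewrite subr_eq0 => /eqP ->.
suff: \int[mu]_x P x + \int[mu]_x f^\- x <= \int[mu]_x B x + \int[mu]_x f^\- x.
  by rewrite leeD2rE.
rewrite -{2}E -!ge0_integralD//.
apply: ge0_le_integral => //.
- by move=> x _; exact: adde_ge0.
- exact: emeasurable_funD.
- exact: emeasurable_funD.
- move=> x _; have := PXB x.
  rewrite -[(X x)%:E]/(f x) {1}(funeposneg f) => h.
  have nf : f^\- x \is a fin_num by rewrite funenegE /maxe; case: ifP.
  rewrite -leeBrDr//; apply: le_trans h _.
  by rewrite [leLHS]addeC addeA.
Qed.

End null_integrals.

(** * The regularized Dirac kernel *)

Section kernel.
Variable R : realType.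
Implicit Types (u v D : R * R * R -> R).

Definition coord (i : 'I_3) (y : R * R * R) : R :=
  if i == 0 then y.1.1 else if i == 1 then y.1.2 else y.2.

Lemma ord3_ind (P : 'I_3 -> Prop) : P 0 -> P 1 -> P 2 -> forall i, P i.
Proof.
move=> P0 P1 P2 -[[|[|[|//]]] i3].
- by rewrite (_ : Ordinal i3 = 0)//; exact/val_inj.
- by rewrite (_ : Ordinal i3 = 1)//; exact/val_inj.
- by rewrite (_ : Ordinal i3 = 2)//; exact/val_inj.
Qed.

Lemma continuous_coord i : continuous (coord i).
Proof.
elim/ord3_ind: i => y; last exact: cvg_snd.
  by apply: continuous_comp; exact: cvg_fst.
by apply: continuous_comp; [exact: cvg_fst|exact: cvg_snd].
Qed.

Lemma is_derive_coord (i j : 'I_3) (y : R * R * R) :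
  is_derive y (basis_vec R j) (coord i) (i == j)%:R.
Proof.
apply/is_derive_line.
have -> : (fun t : R => coord i (t *: basis_vec R j + y)) = 
          (fun t : R => (i == j)%:R * t + coord i y).
  apply/funext => t; rewrite /coord /basis_vec.
  by elim/ord3_ind: i; elim/ord3_ind: j; rewrite /= /GRing.scale/= ?mulr1 ?mulr0 ?mul1r ?mul0r.
apply: is_derive_eq.
by rewrite addr0 [_ *: 1]mulr1.
Qed.

Lemma is_derive_fcomp v (Q : R -> R) (y e : R * R * R) (dv dQ : R) :
  is_derive y e v dv -> is_derive (v y) 1 Q dQ ->
  is_derive y e (fun x => Q (v x)) (dQ * dv).
Proof.
move=> /is_derive_line hv hQ; apply/is_derive_line.
apply: (@is_derive1_comp _ Q (fun t => v (t *: e + y))) => //.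
by rewrite scale0r add0r.
Qed.

Lemma is_derive_fmul u v (y e : R * R * R) (du dv : R) :
  is_derive y e u du -> is_derive y e v dv ->
  is_derive y e (fun x => u x * v x) (u y * dv + v y * du).
Proof. by move=> hu hv; exact: (is_deriveM hu hv). Qed.

Lemma is_derive_fadd u v (y e : R * R * R) (du dv : R) :
  is_derive y e u du -> is_derive y e v dv ->
  is_derive y e (fun x => u x + v x) (du + dv).
Proof. by move=> hu hv; exact: (is_deriveD hu hv). Qed.


Lemma is_derive_coordB (i j : 'I_3) (c y : R * R * R) :
  is_derive y (basis_vec R j) (fun y => coord i y - coord i c) (i == j)%:R.
Proof.
rewrite -[_%:R]subr0; have dc := is_derive_cst (coord i c) y (basis_vec R j).
exact: (is_deriveB (is_derive_coord i j y) dc).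
Qed.

Definition C1_ball u := [/\ continuous u,
  forall j, continuous (partial j u),
  forall j x, derivable u x (basis_vec R j),
  forall x, ~ unit_ball R x -> u x = 0 &
  forall j x, ~ unit_ball R x -> partial j u x = 0].

(** The squared Euclidean distance serves as radial variable because it is smooth at the centre. *)
Definition dist2 (c y : R * R * R) : R :=
  let z i := coord i y - coord i c in z 0 * z 0 + z 1 * z 1 + z 2 * z 2.

Lemma dist2_ge0 c y : 0 <= dist2 c y.
Proof. by rewrite /dist2 -!expr2 !addr_ge0 ?sqr_ge0. Qed.

Lemma continuous_dist2 c : continuous (dist2 c).
Proof.
move=> y; rewrite /dist2.
have cz i : {for y, continuous (fun y => coord i y - coord i c)}.
  by apply: cvgB; [exact: continuous_coord|exact: cvg_cst].
by apply: cvgD; [apply: cvgD|]; apply: cvgM; exact: cz.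
Qed.

Lemma is_derive_dist2 (c y : R * R * R) (j : 'I_3) :
  is_derive y (basis_vec R j) (dist2 c) (2 * (coord j y - coord j c)).
Proof.
have dz i := is_derive_coordB i j c y.
have H i := is_derive_fmul (dz i) (dz i).
have h := is_derive_fadd (is_derive_fadd (H 0) (H 1)) (H 2).
move: h; set r := (X in is_derive _ _ _ X) => h.
rewrite (_ : 2 * _ = r)//.
by rewrite /r; elim/ord3_ind: j {dz H h r}; rewrite /=; ring.
Qed.

Section radial_kernel.
Variables (Q Q' : R -> R) (c : R * R * R).
Hypothesis dQ : forall s : R, 0 <= s -> is_derive s 1 Q (Q' s).
Hypothesis cQ' : forall s : R, 0 <= s -> {for s, continuous Q'}.

Local Notation z i y := (coord i y - coord i c).
Local Notation s y := (dist2 c y).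

(** The integrand is the [j]-th partial derivative of [Q (s y) * z i y * u y]. *)
Lemma null_integral_partial (i j : 'I_3) u : C1_ball u ->
  null_integral (leb3 R) (fun y => Q (s y) * ((i == j)%:R * u y + z i y * partial j u y)
    + 2 * z i y * z j y * Q' (s y) * u y).
Proof.
move=> [cu cpu du u0 pu0].
set D := (X in null_integral _ X).
have cD : continuous D.
  move=> y; have cz l : {for y, continuous (fun y => z l y)}.
    by apply: cvgB; [exact: continuous_coord|exact: cvg_cst].
  have cs : {for y, continuous (dist2 c)} by exact: continuous_dist2.
  have cQs : {for y, continuous (fun y => Q (s y))}.
    apply: (continuous_comp cs); apply: differentiable_continuous.
    by apply/derivable1_diffP; apply: ex_derive; exact: dQ (dist2_ge0 _ _).
  have cQ's : {for y, continuous (fun y => Q' (s y))}.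
    by apply: (continuous_comp cs); exact: cQ' (dist2_ge0 _ _).
  apply: cvgD; apply: cvgM => //; last exact: cu.
    apply: cvgD; apply: cvgM; [exact: cvg_cst|exact: cu|exact: cz|exact: cpu].
  apply: cvgM => //; apply: cvgM; last exact: cz.
  by apply: cvgM; [exact: cvg_cst|exact: cz].
have D0 y : ~ unit_ball R y -> D y = 0.
  by move=> by_; rewrite /D (u0 _ by_) (pu0 _ _ by_); ring.
split; first exact: continuous_ball_integrable.
apply: (@integral_partial0 _ j (fun y => Q (s y) * (z i y * u y))) => // y.
  by move=> by_; rewrite u0// !mulr0.
have dz := is_derive_coordB i j c y.
apply: is_derive_eq.
  apply: is_derive_fmul.
    by apply: (is_derive_fcomp (is_derive_dist2 _ _ _)); exact: dQ (dist2_ge0 _ _).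
  by apply: is_derive_fmul dz _; exact: derivableP.
by rewrite /D -/(partial j u y); ring.
Qed.

(* The vector identity [sigma . z (sigma . grad) = z . grad + i sigma . (z x grad)],
   whose second part is a divergence because the field [Q (|z|^2) z] is
   curl-free. *)
Lemma dirac_kernel_identity (a b c1 d : R * R * R -> R) :
  C1_ball a -> C1_ball b -> C1_ball c1 -> C1_ball d ->
  null_integral (leb3 R) (fun y =>
    Q (s y) * (z 2 y * (partial 2 a y + partial 0 c1 y + partial 1 d y)
             + z 0 y * (partial 0 a y - partial 1 b y - partial 2 c1 y)
             + z 1 y * (partial 1 a y + partial 0 b y - partial 2 d y))
    + (3 * Q (s y) + 2 * s y * Q' (s y)) * a y).
Proof.
move=> ha hb hc hd.
have N i j u (hu : C1_ball u) := null_integral_partial i j hu.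
(* The diagonal terms add up to the divergence of [Q z a]. Each of [b], [c1], [d] enters through an
   antisymmetric pair, in which the [Q'] terms cancel, being symmetric in [i] and [j]. *)
have := null_integralB (null_integralD (null_integralB (null_integralD
 (null_integralB (null_integralD (null_integralD (null_integralD
   (N 0 0 _ ha) (N 1 1 _ ha)) (N 2 2 _ ha)) (N 1 0 _ hb)) (N 0 1 _ hb))
   (N 2 0 _ hc)) (N 0 2 _ hc)) (N 2 1 _ hd)) (N 1 2 _ hd).
congr null_integral; apply/funext => y.
move: (Q (s y)) (Q' (s y)) => qs q's.
have -> : s y = z 0 y * z 0 y + z 1 y * z 1 y + z 2 y * z 2 y by [].
move: (z 0 y) (z 1 y) (z 2 y) => z0 z1 z2 /=.
move: (partial 0 a y) (partial 1 a y) (partial 2 a y) (partial 0 b y)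
  (partial 1 b y) (partial 0 c1 y) (partial 2 c1 y) (partial 1 d y)
  (partial 2 d y) => *.
ring.
Qed.
End radial_kernel.

End kernel.

(** * The regularized and truncated kernel as a function of the squared distance *)

Section cutoff_kernel.
Variable R : realType.

Lemma is_derive_sqr_max0 (t : R) :
  is_derive t 1 (fun u : R => Num.max u 0 ^+ 2) (2 * Num.max t 0).
Proof.
have [t0|t0|->] := ltgtP t 0.
- apply: (@near_eq_is_derive _ _ _ (cst 0)); last first.
    by rewrite mulr0; exact: is_derive_cst.
  near=> u; rewrite /= (_ : Num.max u 0 = 0) ?expr0n//; apply/max_r/ltW.
  by near: u; exact: lt_nbhsl.
- apply: (@near_eq_is_derive _ _ _ (fun u : R => u ^+ 2)); last first.
    apply: is_derive_eq.
    by rewrite [_ *: 1]mulr1 mulr2n mulrDl mul1r.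
  near=> u; rewrite (_ : Num.max u 0 = u)//; apply/max_l/ltW.
  by near: u; exact: lt_nbhsr.
- apply/is_derive1_caratheodory; exists (fun u : R => Num.max u 0); split.
  + move=> z; rewrite maxxx expr0n subr0 subr0 expr2.
    by have [z0|z0] := leP z 0; rewrite ?mul0r.
  + by apply: continuous_max; [exact: cvg_id|exact: cvg_cst].
  + by rewrite maxxx mulr0.
Unshelve. all: by end_near. Qed.

Variables e rho : R.
Hypotheses (e0 : 0 < e) (rho0 : 0 < rho).

Definition regdist (s : R) : R := Num.sqrt (s + e ^+ 2).
Local Notation m := regdist.

(** The outer square makes the truncation continuously differentiable at [s = rho ^+ 2]. The inner
    square makes the derivative vanish at [s = 0]; otherwise the cutoff term of the divergence would
    have size [1 / (m rho^2)] near the centre, which is not bounded uniformly in [e]. *)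
Definition cutoff (s : R) : R := Num.max (1 - (s / rho ^+ 2) ^+ 2) 0 ^+ 2.
Definition cutoff' (s : R) : R :=
  - (4 * (s / rho ^+ 4) * Num.max (1 - (s / rho ^+ 2) ^+ 2) 0).

Definition radial (s : R) : R := (m s)^-1 ^+ 3 * cutoff s.
Definition radial' (s : R) : R :=
  - (3 / 2) * (m s)^-1 ^+ 5 * cutoff s + (m s)^-1 ^+ 3 * cutoff' s.

Lemma regdist_gt0 (s : R) : 0 <= s -> 0 < m s.
Proof. by move=> s0; rewrite sqrtr_gt0 ltr_wpDl// exprn_gt0. Qed.

Lemma sqr_regdist (s : R) : 0 <= s -> m s ^+ 2 = s + e ^+ 2.
Proof. by move=> s0; rewrite sqr_sqrtr// addr_ge0// sqr_ge0. Qed.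

Lemma is_derive_cutoff (s : R) : is_derive s 1 cutoff (cutoff' s).
Proof.
have h : is_derive s 1 (fun s : R => 1 - (s / rho ^+ 2) ^+ 2) (- (2 * (s / rho ^+ 2) * (rho ^+ 2)^-1)).
  apply: is_derive_eq.
  by rewrite /= /GRing.scale/=; field; rewrite gt_eqF.
have := @is_derive1_comp _ (fun u : R => Num.max u 0 ^+ 2) _ s _ _ (is_derive_sqr_max0 _) h.
rewrite (_ : _ * _ = cutoff' s)// /cutoff'.
have : rho != 0 by rewrite gt_eqF.
move: (Num.max _ _) => M r0; by field.
Qed.

Lemma is_derive_radial (s : R) : 0 <= s -> is_derive s 1 radial (radial' s).
Proof.
move=> s0; have m0 := regdist_gt0 s0.
have hm : is_derive s 1 regdist (2 * m s)^-1.
  have := @is_derive1_comp _ Num.sqrt (fun s => s + e ^+ 2) s (2 * m s)^-1 1.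
  rewrite mulr1; apply.
    by apply: is_derive1_sqrt; rewrite -sqrtr_gt0.
  by apply: is_derive_eq; rewrite addr0.
have ms0 : m s != 0 by rewrite gt_eqF.
have hV := is_deriveV ms0 hm.
have := is_deriveM (is_deriveX 3 hV) (is_derive_cutoff s).
rewrite [X in is_derive _ _ _ X -> _](_ : _ = radial' s)//.
rewrite /radial' /= /GRing.scale /=.
have -> : ((fun s => (m s)^-1) ^+ 3) s = (m s)^-1 ^+ 3 by [].
move: (cutoff s) (cutoff' s) => a b; field.
by [].
Qed.


Lemma continuous_radial' (s : R) : 0 <= s -> {for s, continuous radial'}.
Proof.
move=> s0; have ms0 : m s != 0 by rewrite gt_eqF// regdist_gt0.
have cm : {for s, continuous m}.
  apply: continuous_comp; last exact: sqrt_continuous.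
  by apply: cvgD; [exact: cvg_id|exact: cvg_cst].
have cV n : {for s, continuous (fun s => (m s)^-1 ^+ n)}.
  apply: (@continuous_comp _ _ _ (fun s => (m s)^-1) (fun u => u ^+ n)).
    exact: cvgV.
  exact: exprn_continuous.
have ct : {for s, continuous (fun s : R => Num.max (1 - (s / rho ^+ 2) ^+ 2) 0)}.
  apply: continuous_max; last exact: cvg_cst.
  apply: cvgB; first exact: cvg_cst.
  have cs2 : {for s, continuous (fun s : R => s / rho ^+ 2)}.
    by apply: cvgM; [exact: cvg_id|exact: cvg_cst].
  exact: (cvgM cs2 cs2).
apply: cvgD.
  apply: cvgM.
    by apply: cvgM; [exact: cvg_cst|exact: cV].
  exact: (cvgM ct ct).
apply: cvgM; first exact: cV.
apply: cvgN; apply: cvgM => //.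
apply: cvgM; first exact: cvg_cst.
by apply: cvgM; [exact: cvg_id|exact: cvg_cst].
Qed.

(* The first term is an approximate delta function; the second lives where the
   cutoff varies and is the source of the mean of [|a|] in [local_estimate]. *)
Lemma divergence_radial (s : R) : 0 <= s ->
  3 * radial s + 2 * s * radial' s =
  3 * e ^+ 2 * (m s)^-1 ^+ 5 * cutoff s + 2 * s * (m s)^-1 ^+ 3 * cutoff' s.
Proof.
move=> s0; have ms0 : m s != 0 by rewrite gt_eqF// regdist_gt0.
rewrite /radial /radial'; move: (cutoff s) (cutoff' s) => a b.
have -> : s = m s ^+ 2 - e ^+ 2 by rewrite sqr_regdist// addrK.
rewrite (_ : m (m s ^+ 2 - e ^+ 2) = m s); last by rewrite sqr_regdist// addrK.
by field.
Qed.

Lemma cutoff_ge0 s : 0 <= cutoff s.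
Proof. exact: sqr_ge0. Qed.

Lemma cutoff_le1 s : cutoff s <= 1.
Proof.
rewrite /cutoff expr_le1// ?le_max ?lexx ?orbT//.
by rewrite ge_max ler01 andbT gerBl sqr_ge0.
Qed.

Lemma cutoff_max0 s : rho ^+ 2 <= s -> Num.max (1 - (s / rho ^+ 2) ^+ 2) 0 = 0.
Proof.
move=> h; apply/max_r; rewrite subr_le0 expr_ge1//.
  by rewrite ler_pdivlMr ?mul1r// exprn_gt0.
by rewrite divr_ge0 ?sqr_ge0// (le_trans _ h)// sqr_ge0.
Qed.

Lemma cutoff_eq0 s : rho ^+ 2 <= s -> cutoff s = 0.
Proof. by move=> /cutoff_max0 h; rewrite /cutoff h expr0n. Qed.

Lemma cutoff'_eq0 s : rho ^+ 2 <= s -> cutoff' s = 0.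
Proof. by move=> /cutoff_max0 h; rewrite /cutoff' h mulr0 oppr0. Qed.

Lemma cutoff_ge_half s : 0 <= s -> s <= rho ^+ 2 / 2 -> 2^-1 <= cutoff s.
Proof.
move=> s0 h; set t := s / rho ^+ 2.
have t0 : 0 <= t by rewrite divr_ge0// sqr_ge0.
have t2 : t <= 2^-1 by rewrite ler_pdivrMr ?exprn_gt0// mulrC.
have tt : t ^+ 2 <= 4^-1 by nra.
rewrite /cutoff -/t.
have : 3 / 4 <= Num.max (1 - t ^+ 2) 0 by rewrite le_max; apply/orP; left; lra.
by move: (Num.max _ _) => M HM; nra.
Qed.

(** The bound is free of [e]: the factor [s / rho ^+ 4] of [cutoff'] leaves at most
    [8 s^2 m^-3 rho^-4 <= 8 m rho^-4], and [m <= 2 rho] where [cutoff'] is nonzero. *)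
Lemma cutoff'_bound s : 0 <= s -> e <= rho ->
  `|2 * s * (m s)^-1 ^+ 3 * cutoff' s| <= 16 * rho^-1 ^+ 3.
Proof.
move=> s0 er; have m0 := regdist_gt0 s0.
have r30 : 0 <= 16 * rho^-1 ^+ 3.
  by rewrite mulr_ge0// exprn_ge0// invr_ge0 ltW.
have [h|h] := leP (rho ^+ 2) s; first by rewrite cutoff'_eq0// mulr0 normr0.
have M1 : Num.max (1 - (s / rho ^+ 2) ^+ 2) 0 <= 1.
  by rewrite ge_max ler01 andbT gerBl sqr_ge0.
have M0 : 0 <= Num.max (1 - (s / rho ^+ 2) ^+ 2) 0 by rewrite le_max lexx orbT.
rewrite /cutoff' mulrN normrN ger0_norm; last first.
  rewrite !mulr_ge0// ?invr_ge0 ?sqrtr_ge0// ?exprn_ge0 ?ltW//.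
apply: (@le_trans _ _ (2 * s * (m s)^-1 ^+ 3 * (4 * (s / rho ^+ 4)))).
  rewrite ler_wpM2l//; last by rewrite ler_piMr// mulr_ge0// divr_ge0// exprn_ge0 ?ltW//.
  by rewrite !mulr_ge0// ?invr_ge0 ?sqrtr_ge0.
have m2r : m s <= 2 * rho.
  rewrite -(@ler_pXn2r _ 2)// ?nnegrE ?ltW ?mulr_gt0// sqr_regdist//.
  by move: er h e0 => *; nra.
have sm : s <= m s ^+ 2 by rewrite sqr_regdist// lerDl sqr_ge0.
apply: (@le_trans _ _ (8 * m s * rho^-1 ^+ 4)).
  have -> : 2 * s * (m s)^-1 ^+ 3 * (4 * (s / rho ^+ 4)) =
     8 * (s ^+ 2 * (m s)^-1 ^+ 3) * rho^-1 ^+ 4.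
    by field; rewrite !gt_eqF.
  rewrite ler_wpM2r ?exprn_ge0 ?invr_ge0 ?(ltW rho0)// ler_wpM2l//.
  rewrite exprVn ler_pdivrMr ?exprn_gt0// -exprS -[leRHS]/(m s ^+ (2 * 2)) exprM.
  by rewrite ler_pXn2r// ?nnegrE ?sqr_ge0.
have -> : 16 * rho^-1 ^+ 3 = 8 * (2 * rho) * rho^-1 ^+ 4.
  by field; rewrite gt_eqF.
by rewrite ler_wpM2r ?exprn_ge0 ?invr_ge0 ?(ltW rho0)// ler_wpM2l.
Qed.


End cutoff_kernel.

(** * A dyadic majorant of the truncated inverse-square kernel *)

Section dyadic_kernel.
Variable R : realType.
Implicit Types (rho : R) (x y : R * R * R).

(* Dominates the kernel [|y - x|^-2] truncated to [|y - x| < rho], with integral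
   [O(rho)]. *)
Definition dyadic_kernel (rho : R) (x y : R * R * R) : \bar R :=
  (\sum_(n <oo) (4 * (rho / 2 ^+ n)^-1 ^+ 2 * \1_(box x (rho / 2 ^+ n)) y)%:E)%E.

Lemma dyadic_term_ge0 rho x y n :
  (0%:E <= (4 * (rho / 2 ^+ n)^-1 ^+ 2 * \1_(box x (rho / 2 ^+ n)) y)%:E)%E.
Proof. by rewrite lee_fin mulr_ge0// mulr_ge0// sqr_ge0. Qed.

Lemma dyadic_kernel_ge0 rho x y : (0 <= dyadic_kernel rho x y)%E.
Proof. by apply: nneseries_ge0 => n _ _; exact: dyadic_term_ge0. Qed.

Lemma dyadic_scale rho (w : R) : 0 < w -> w < rho ->
  exists n, rho / 2 ^+ n.+1 <= w < rho / 2 ^+ n.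
Proof.
move=> w0 wr; have r0 := lt_trans w0 wr.
have ex : exists n, rho / 2 ^+ n <= w.
  have [n] : exists n, rho / w < n%:R.
    by exists (Num.truncn (rho / w)).+1; rewrite truncnS_gt.
  move=> hn; exists n; rewrite ler_pdivrMr ?exprn_gt0// mulrC -ler_pdivrMr//.
  by rewrite (le_trans (ltW hn))// -natrX ler_nat ltnW// ltn_expl.
case: (ex_minnP ex) => -[|n]; first by rewrite expr0 divr1 leNgt wr.
move=> h hmin; exists n; rewrite h/= ltNge; apply/negP => /hmin.
by rewrite ltnn.
Qed.

Lemma coord_le_dist2 (i : 'I_3) x y : (coord i y - coord i x) ^+ 2 <= dist2 x y.
Proof.
by rewrite /dist2; elim/ord3_ind: i; rewrite /= expr2 -!expr2 ?lerDr ?addr_ge0 ?sqr_ge0//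
  -addrA ?lerDl ?addr_ge0 ?sqr_ge0// addrCA lerDl addr_ge0 ?sqr_ge0.
Qed.

Lemma dist2_box x y (d : R) : 0 < d -> dist2 x y < d ^+ 2 -> box x d y.
Proof.
move=> d0 h; have H i : `|coord i y - coord i x| < d.
  rewrite -(@ltr_pXn2r _ 2)// ?nnegrE ?ltW// real_normK ?num_real//.
  exact: le_lt_trans (coord_le_dist2 i x y) h.
by split; [exact: (H 0)|split; [exact: (H 1)|exact: (H 2)]].
Qed.

Lemma box_dist2 x y (d : R) : 0 < d -> box x d y -> dist2 x y <= 3 * d ^+ 2.
Proof.
move=> d0 [h1 [h2 h3]].
have H (t : R) : `|t| < d -> t * t <= d ^+ 2.
  move=> td; rewrite -expr2 -real_normK ?num_real// ler_pXn2r ?nnegrE ?(ltW d0)//.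
  exact: ltW.
have := H _ h1; have := H _ h2; have := H _ h3.
by rewrite /dist2/= /coord/=; lra.
Qed.

(** A single term suffices. If the distance [w] satisfies [rho / 2^(n+1) <= w < rho / 2^n], then
    [w M^-3 <= w^-2 <= 4 (rho / 2^n)^-2], whence the factor 4 in the kernel. [M] stands for the
    regularized distance, so [e] drops out here. *)
Lemma dyadic_kernel_ge rho x y (M : R) : 0 < M -> dist2 x y <= M ^+ 2 ->
  dist2 x y < rho ^+ 2 -> 0 < rho ->
  ((Num.sqrt (dist2 x y) * M^-1 ^+ 3)%:E <= dyadic_kernel rho x y)%E.
Proof.
move=> M0 dM dr r0.
have [d0|d0] := leP (dist2 x y) 0.
  by rewrite ler0_sqrtr// mul0r dyadic_kernel_ge0.
set w := Num.sqrt (dist2 x y).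
have w0 : 0 < w by rewrite sqrtr_gt0.
have w2 : w ^+ 2 = dist2 x y by rewrite sqr_sqrtr// ltW.
have wr : w < rho by rewrite -(@ltr_pXn2r _ 2)// ?nnegrE ?ltW// w2.
have wM : w <= M by rewrite -(@ler_pXn2r _ 2)// ?nnegrE ?(ltW w0) ?(ltW M0)// w2.
have [n /andP[n1 n2]] := dyadic_scale w0 wr.
have dn0 : 0 < rho / 2 ^+ n by rewrite divr_gt0// exprn_gt0.
apply: (@le_trans _ _ (4 * (rho / 2 ^+ n)^-1 ^+ 2 * \1_(box x (rho / 2 ^+ n)) y)%:E).
  rewrite lee_fin indicE mem_set ?mulr1; last first.
    by apply: dist2_box => //; rewrite -w2 ltr_pXn2r// nnegrE ltW.
  apply: (@le_trans _ _ (w^-1 ^+ 2)).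
    apply: (@le_trans _ _ (M * M^-1 ^+ 3)).
      by rewrite ler_wpM2r ?exprn_ge0 ?invr_ge0 ?(ltW M0).
    rewrite (_ : M * _ = M^-1 ^+ 2); last by field; rewrite gt_eqF.
    by rewrite ler_pXn2r// ?nnegrE ?invr_ge0 ?(ltW M0) ?(ltW w0)// lef_pV2.
  rewrite (_ : 4 * _ = (rho / 2 ^+ n.+1)^-1 ^+ 2); last first.
    rewrite [2 ^+ n.+1]exprS; have : 2 ^+ n != 0 :> R by rewrite expf_neq0.
    by move: (2 ^+ n) => t t0; field; rewrite t0 gt_eqF.
  have dn1 : 0 < rho / 2 ^+ n.+1 by rewrite divr_gt0// exprn_gt0.
  by rewrite ler_pXn2r// ?nnegrE ?invr_ge0 ?(ltW w0) ?(ltW dn1)// lef_pV2.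
rewrite /dyadic_kernel (@nneseriesD1 _ _ n xpredT)//; last by move=> *; exact: dyadic_term_ge0.
by rewrite leeDl// nneseries_ge0// => *; exact: dyadic_term_ge0.
Qed.

End dyadic_kernel.

(** * Weak-type estimate for one real component *)

Section local_estimate.
Variable R : realType.
Implicit Types (x y : R * R * R).

Lemma measurable_dyadic_kernel (rho : R) x :
  measurable_fun setT (dyadic_kernel rho x : borel3 R -> \bar R).
Proof.
apply: ge0_emeasurable_sum => [n y _ _|n _]; first exact: dyadic_term_ge0.
apply/measurable_EFinP; apply: measurable_funM => //.
by apply: measurable_indic; exact: measurable_box.
Qed.

(** The witness is [|z| m^-3] within distance [rho] and 0 beyond. Passing through a real [kappa]
    keeps the estimate in [R], whereas [dyadic_kernel] is infinite at [y = x]. *)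
Lemma kernel_drift_bound (e rho : R) x y (H0 H1 H2 G : R) : 0 < e -> 0 < rho ->
  `|H0| <= G -> `|H1| <= G -> `|H2| <= G ->
  let z i := coord i y - coord i x in
  exists kappa, [/\ 0 <= kappa, (kappa%:E <= dyadic_kernel rho x y)%E &
    `|radial e rho (dist2 x y) * (z 2 * H0 + z 0 * H1 + z 1 * H2)| <= 3 * (kappa * G)].
Proof.
move=> e0 rho0 hH0 hH1 hH2 z; have s0 := dist2_ge0 x y.
have m0 := regdist_gt0 e0 s0.
have G0 : 0 <= G by exact: le_trans hH0.
have [h|h] := leP (rho ^+ 2) (dist2 x y).
  exists 0; rewrite dyadic_kernel_ge0 lexx; split => //.
  by rewrite /radial cutoff_eq0// mulr0 mul0r normr0 mul0r mulr0.
exists (Num.sqrt (dist2 x y) * (regdist e (dist2 x y))^-1 ^+ 3); split.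
- by rewrite mulr_ge0 ?sqrtr_ge0// exprn_ge0// invr_ge0 ltW.
- by apply: dyadic_kernel_ge => //; rewrite sqr_regdist// lerDl sqr_ge0.
set w := Num.sqrt _.
have zw i : `|z i| <= w.
  rewrite -(@ler_pXn2r _ 2)// ?nnegrE ?sqrtr_ge0//.
  by rewrite real_normK ?num_real// sqr_sqrtr//; exact: coord_le_dist2.
have zH i H : `|H| <= G -> `|z i * H| <= w * G.
  by move=> hH; rewrite normrM ler_pM.
have hz : `|z 2 * H0 + z 0 * H1 + z 1 * H2| <= 3 * (w * G).
  have := ler_normD (z 2 * H0 + z 0 * H1) (z 1 * H2).
  have := ler_normD (z 2 * H0) (z 0 * H1).
  by have := zH 2 _ hH0; have := zH 0 _ hH1; have := zH 1 _ hH2; lra.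
have -> : 3 * (w * (regdist e (dist2 x y))^-1 ^+ 3 * G) =
          (regdist e (dist2 x y))^-1 ^+ 3 * 1 * (3 * (w * G)) by ring.
rewrite normrM ler_pM// /radial normrM ler_pM//.
  by rewrite ger0_norm// exprn_ge0// invr_ge0 ltW.
by rewrite ger0_norm ?cutoff_ge0// cutoff_le1.
Qed.

(** Three zones. On the [e]-box, [m <= 2 e], the cutoff is at least 1/2 and [u >= lam / 2], so the
    right-hand side is at least [3 e^2 (2 e)^-5 (1/2) (lam/2)], the stated constant. On the rest of
    the [eta]-box it is nonnegative. Outside, [m >= eta], and what remains is [O(e^2)]. *)
Lemma kernel_mass_bound (e rho eta lam u : R) x y : 0 < e -> e <= eta -> e <= rho / 3 ->
  0 < lam -> (box x eta y -> lam / 2 <= u) ->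
  (3 / 128 * e^-1 ^+ 3 * lam) * \1_(box x e) y
    - 3 * e ^+ 2 * eta^-1 ^+ 5 * `|u| <=
  3 * e ^+ 2 * (regdist e (dist2 x y))^-1 ^+ 5 * cutoff rho (dist2 x y) * u.
Proof.
move=> e0 eeta er lam0 hu; have s0 := dist2_ge0 x y.
have m0 := regdist_gt0 e0 s0.
have eta0 := lt_le_trans e0 eeta.
have rho0 : 0 < rho by lra.
have c0 := @cutoff_ge0 _ rho (dist2 x y).
have c1 := @cutoff_le1 _ rho (dist2 x y).
set m := regdist e (dist2 x y) in m0 *.
have m5 : 0 <= m^-1 ^+ 5 by rewrite exprn_ge0// invr_ge0 ltW.
have eta5 : 0 <= eta^-1 ^+ 5 by rewrite exprn_ge0// invr_ge0 ltW.
have e20 : 0 <= 3 * e ^+ 2 by rewrite mulr_ge0// sqr_ge0.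
have i2e : 0 <= (2 * e)^-1 ^+ 5 by rewrite exprn_ge0// invr_ge0 mulr_ge0// ltW.
have k2 : 0 <= 3 * e ^+ 2 * eta^-1 ^+ 5 * `|u|.
  by rewrite mulr_ge0// mulr_ge0 ?eta5// mulr_ge0// sqr_ge0.
have [bey|nbe] := pselect (box x e y).
  rewrite indicE mem_set// mulr1.
  have beta : box x eta y by case: bey => [h1 [h2 h3]]; split; [|split]; exact: lt_le_trans eeta.
  apply: (@le_trans _ _ (3 / 128 * e^-1 ^+ 3 * lam)); first by rewrite gerBl.
  have s3 := box_dist2 e0 bey.
  have m2e : m <= 2 * e.
    rewrite -(@ler_pXn2r _ 2)// ?nnegrE ?mulr_ge0 ?(ltW m0) ?(ltW e0)//.
    by rewrite sqr_regdist//; move: s3; rewrite exprMn; lra.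
  have ch : 2^-1 <= cutoff rho (dist2 x y).
    by apply: cutoff_ge_half => //; apply: (le_trans s3); move: er e0; nra.
  have -> : 3 / 128 * e^-1 ^+ 3 * lam =
    3 * e ^+ 2 * ((2 * e)^-1 ^+ 5) * 2^-1 * (lam / 2) by field; rewrite gt_eqF.
  apply: ler_pM; [..|exact: hu].
  - by rewrite mulr_ge0 ?invr_ge0// mulr_ge0.
  - by rewrite divr_ge0// ltW.
  apply: ler_pM; [..|exact: ch] => //.
    by rewrite mulr_ge0.
  rewrite ler_wpM2l// ler_pXn2r// ?nnegrE ?invr_ge0 ?mulr_ge0 ?(ltW m0) ?(ltW e0)//.
  by rewrite lef_pV2 ?posrE ?mulr_gt0.
rewrite indicE memNset// mulr0 sub0r.
have [beta|nbeta] := pselect (box x eta y).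
  rewrite (@le_trans _ _ 0)// ?oppr_le0//.
  have u0 : 0 <= u by rewrite (le_trans _ (hu beta))// divr_ge0// ltW.
  by rewrite mulr_ge0// mulr_ge0// mulr_ge0.
have em : eta <= m.
  have em2 : eta ^+ 2 <= dist2 x y.
    by rewrite leNgt; apply/negP => /(dist2_box eta0).
  rewrite -(@ler_pXn2r _ 2)// ?nnegrE ?(ltW eta0) ?(ltW m0)// sqr_regdist//.
  by rewrite (le_trans em2)// lerDl sqr_ge0.
have : `|3 * e ^+ 2 * m^-1 ^+ 5 * cutoff rho (dist2 x y) * u| <= 3 * e ^+ 2 * eta^-1 ^+ 5 * `|u|.
  rewrite normrM ler_pM// normrM (ger0_norm c0).
  rewrite -[leRHS]mulr1 ler_pM// ger0_norm ?(mulr_ge0 e20 m5)//.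
  rewrite ler_wpM2l// ler_pXn2r// ?nnegrE ?invr_ge0 ?(ltW m0) ?(ltW eta0)//.
  by rewrite lef_pV2 ?posrE.
by rewrite ler_norml => /andP[].
Qed.

(** The mass near [x] integrates to [(3/128) e^-3 lam (2 e)^3 = 3 lam / 16] whatever [e] is. The far
    part is made at most [lam / 16], and the difference is the [lam / 8] on the left. *)
Lemma local_estimate (a b c1 d G : R * R * R -> R) x (lam rho : R) :
  C1_ball a -> C1_ball b -> C1_ball c1 -> C1_ball d ->
  measurable_fun setT (G : borel3 R -> R) ->
  (forall y, `|partial 2 a y + partial 0 c1 y + partial 1 d y| <= G y) ->
  (forall y, `|partial 0 a y - partial 1 b y - partial 2 c1 y| <= G y) ->
  (forall y, `|partial 1 a y + partial 0 b y - partial 2 d y| <= G y) ->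
  0 < rho -> 0 < lam -> lam < a x ->
  ((lam / 8)%:E <= (16 * rho^-1 ^+ 3)%:E * \int[leb3 R]_(y in box x rho) `|a y|%:E
    + 3%:E * \int[leb3 R]_y (dyadic_kernel rho x y * (G y)%:E))%E.
Proof.
move=> ha hb hc hd mG hH0 hH1 hH2 rho0 lam0 lamx.
have G0 y : 0 <= G y by exact: le_trans (hH0 y).
have [ca _ _ a0 _] := ha.
have ia := continuous_ball_integrable ca a0.
have ma : measurable_fun setT (a : borel3 R -> R) by exact: continuous3_measurable_fun.
have mna : measurable_fun setT (fun y : borel3 R => `|a y|) by exact: measurableT_comp.
pose A := fine (\int[leb3 R]_y `|a y|%:E)%E.
have AE : (\int[leb3 R]_y `|a y|%:E = A%:E)%E.
  by rewrite fineK// ge0_fin_numE ?integral_ge0//; move/integrableP : ia => [].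
have A0 : 0 <= A by rewrite fine_ge0// integral_ge0.
have [eta eta0 aeta] : exists2 eta, 0 < eta & forall y, box x eta y -> lam / 2 <= a y.
  have : \forall y \near x, lam / 2 < a y.
    by apply: (cvgr_gt _ (ca x)); rewrite (lt_trans _ lamx)// ltr_pdivrMr// ltr_pMr// ltr1n.
  move=> /nbhs_ballP[eta /= eta0 h]; exists eta => // y yx.
  by apply/ltW/h; rewrite ball3E.
(* The first two bounds are those of [kernel_mass_bound]. The last two give [far]: since [e <= 1],
   [e ^+ 2] may be replaced by [e], and [A + 1] avoids a division by zero. *)
pose e := Num.min (Num.min eta (rho / 3)) (Num.min 1 (lam * eta ^+ 5 / (48 * (A + 1)))).
have A1 : 0 < A + 1 by rewrite ltr_wpDl.
have e0 : 0 < e.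
  by rewrite !lt_min eta0 ltr01 !divr_gt0// ?mulr_gt0// exprn_gt0.
have eeta : e <= eta by rewrite !ge_min lexx.
have er : e <= rho / 3 by rewrite !ge_min lexx orbT.
have e1 : e <= 1 by rewrite !ge_min lexx !orbT.
have eA : e <= lam * eta ^+ 5 / (48 * (A + 1)) by rewrite !ge_min lexx !orbT.
have far : 3 * e ^+ 2 * eta^-1 ^+ 5 * A <= lam / 16.
  have h : 48 * e * A <= lam * eta ^+ 5.
    apply: (@le_trans _ _ (48 * (A + 1) * e)); first by nra.
    by move: eA; rewrite ler_pdivlMr ?mulr_gt0// mulrC.
  rewrite exprVn mulrAC ler_pdivrMr ?exprn_gt0//.
  have e20 : 0 <= e * A by rewrite mulr_ge0// ltW.
  have e21 : e ^+ 2 * A <= e * A by rewrite ler_wpM2r// expr2 ler_piMr// ltW.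
  lra.
pose K y := dyadic_kernel rho x y.
pose k1 := 3 / 128 * e^-1 ^+ 3 * lam.
have k10 : 0 <= k1 by rewrite mulr_ge0 ?(ltW lam0)// mulr_ge0 ?exprn_ge0 ?invr_ge0 ?(ltW e0).
pose k2 := 3 * e ^+ 2 * eta^-1 ^+ 5.
have k20 : 0 <= k2.
  by rewrite mulr_ge0 ?exprn_ge0 ?invr_ge0 ?(ltW eta0)// mulr_ge0// sqr_ge0.
pose k3 := 16 * rho^-1 ^+ 3.
have k30 : 0 <= k3 by rewrite mulr_ge0 ?exprn_ge0 ?invr_ge0 ?(ltW rho0).
(* [P] is the mass at [x], [B1] the far part of the approximate delta, [B2] the variation of the
   cutoff and [B3] the Dirac term. *)
pose P (y : borel3 R) : \bar R := (k1 * \1_(box x e) y)%:E.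
pose B1 (y : borel3 R) : \bar R := (k2%:E * `|a y|%:E)%E.
pose B2 (y : borel3 R) : \bar R := (k3%:E * (`|a y| * \1_(box x rho) y)%:E)%E.
pose B3 (y : borel3 R) : \bar R := (3%:E * (K y * (G y)%:E))%E.
have mB1 : measurable_fun setT B1.
  by apply: emeasurable_funM => //; exact/measurable_EFinP.
have mbox c r : measurable (box c r : set (borel3 R)) by exact: measurable_box.
have mb2 : measurable_fun setT (fun y : borel3 R => (`|a y| * \1_(box x rho) y)%:E).
  by apply/measurable_EFinP; apply: measurable_funM.
have mB2 : measurable_fun setT B2 by exact: emeasurable_funM.
have mKG : measurable_fun setT (fun y : borel3 R => K y * (G y)%:E)%E.
  by apply: emeasurable_funM; [exact: measurable_dyadic_kernel|exact/measurable_EFinP].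
have mB3 : measurable_fun setT B3 by exact: emeasurable_funM.
have K0 y : (0 <= K y)%E by exact: dyadic_kernel_ge0.
have B10 y : (0 <= B1 y)%E by rewrite /B1 -EFinM lee_fin mulr_ge0.
have B20 y : (0 <= B2 y)%E by rewrite /B2 -EFinM lee_fin mulr_ge0// mulr_ge0.
have B30 y : (0 <= B3 y)%E by rewrite mule_ge0// mule_ge0// lee_fin.
have X0 := dirac_kernel_identity x (is_derive_radial e0 rho0)
  (@continuous_radial' _ e rho e0) ha hb hc hd.
have := @le_integral_null _ _ R (leb3 R) P (fun y => B1 y + B2 y + B3 y)%E _ _ _ _ _ X0.
have -> : (\int[leb3 R]_y P y = (3 / 16 * lam)%:E)%E.
  rewrite (@integralZl_indic _ _ R (leb3 R) setT measurableT (fun=> box x e))//; last first.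
    by rewrite ltNge k10.
  rewrite integral_indic// setIT -[X in (_ * X)%E]/(leb3 R (box x e)) leb3_box// -EFinM.
  by congr EFin; rewrite /k1; field; rewrite gt_eqF.
rewrite ge0_integralD//; [|by move=> y _; exact: adde_ge0|exact: emeasurable_funD].
rewrite ge0_integralD//.
have Zl (k : R) (f : borel3 R -> \bar R) : 0 <= k -> (forall y, 0 <= f y)%E ->
    measurable_fun setT f ->
    (\int[leb3 R]_y (k%:E * f y) = k%:E * \int[leb3 R]_y f y)%E.
  by move=> kk f0 mf; rewrite ge0_integralZl_EFin.
have KG0 y : (0 <= K y * (G y)%:E)%E by rewrite mule_ge0// lee_fin.
have ba0 y : (0 <= (`|a y| * \1_(box x rho) y)%:E)%E by rewrite lee_fin mulr_ge0.
have mna' : measurable_fun setT (fun y : borel3 R => `|a y|%:E).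
  exact/measurable_EFinP.
rewrite !Zl//.
have -> : (\int[leb3 R]_y (`|a y| * \1_(box x rho) y)%:E =
   \int[leb3 R]_(y in box x rho) `|a y|%:E)%E.
  by rewrite [RHS]integral_mkcond/= epatch_indic; under [RHS]eq_integral do rewrite /= -EFinM.
rewrite AE => H.
have {}H : ((3 / 16 * lam)%:E <= k2%:E * A%:E + (k3%:E * \int[leb3 R]_(y in box x rho) `|a y|%:E
    + 3%:E * \int[leb3 R]_y (K y * (G y)%:E)))%E.
  rewrite addeA; apply: H => //.
  - by apply/measurable_EFinP; apply: measurable_funM.
  - by apply: emeasurable_funD => //; exact: emeasurable_funD.
  - by move=> y; rewrite lee_fin mulr_ge0.
  - by move=> y; rewrite adde_ge0// adde_ge0.
  move=> y.
  have s0 := dist2_ge0 x y.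
  have [kap [kap0 kapK hkap]] := kernel_drift_bound x y e0 rho0 (hH0 y) (hH1 y) (hH2 y).
  have mass := kernel_mass_bound e0 eeta er lam0 (aeta y).
  have hW2 : `|2 * dist2 x y * (regdist e (dist2 x y))^-1 ^+ 3 * cutoff' rho (dist2 x y) * a y|
    <= k3 * (`|a y| * \1_(box x rho) y).
    rewrite normrM.
    have [h|h] := leP (rho ^+ 2) (dist2 x y).
      by rewrite cutoff'_eq0// mulr0 normr0 mul0r mulr_ge0// mulr_ge0.
    rewrite indicE mem_set; last exact: dist2_box.
    rewrite mulr1 ler_wpM2r//; apply: cutoff'_bound => //.
    by rewrite (le_trans er)// ler_pdivrMr// ler_peMr ?(ltW rho0)// ler1n.
  have kG : ((3 * (kap * G y))%:E <= B3 y)%E.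
    by rewrite /B3 EFinM EFinM lee_wpmul2l// lee_wpmul2r// lee_fin.
  rewrite divergence_radial//.
  apply: le_trans (leeD2l _ (leeD2l _ kG)).
  rewrite /P /B1 /B2 -!EFinM -!EFinD lee_fin.
  move: hkap hW2 mass; rewrite !ler_norml -/k1 -/k2.
  set T1 := radial _ _ _ * _; set T2 := (_ * cutoff' _ _ * _); set T3 := (_ * cutoff _ _ * _).
  move=> /andP[h1 _] /andP[h2 _] h3.
  rewrite [X in T1 + X](mulrDl _ _ (a y)) -/T2 -/T3.
  lra.
have : ((lam / 8 + k2 * A)%:E <= (3 / 16 * lam)%:E)%E.
  by rewrite lee_fin; move: far; rewrite -/k2; lra.
move=> /le_trans/(_ H); rewrite EFinD addeC -EFinM leeD2lE//.
Qed.
End local_estimate.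

(** * From the pointwise bound to the measure of level sets *)

Section weak_type.
Variable R : realType.
Implicit Types (x y : R * R * R).

(* Young-type substitute for Jensen's inequality: integrated against a measure of
   mass [M] it bounds a mean by the level [t] plus a multiple of the [p]-th moment. *)
Lemma le_add_powR (t g p : R) : 0 < t -> 0 <= g -> 1 <= p ->
  g <= t + t / t `^ p * g `^ p.
Proof.
move=> t0 g0 p1; have [gt|tg] := leP g t.
  by rewrite (le_trans gt)// lerDl mulr_ge0 ?powR_ge0// divr_ge0 ?powR_ge0// ltW.
have tp0 : t `^ p != 0 by rewrite gt_eqF// powR_gt0.
apply: (@le_trans _ _ (t * (g / t) `^ p)).
  rewrite -{1}(mulfVK (lt0r_neq0 t0) g) mulrC ler_wpM2l ?(ltW t0)//.
  by apply: le1r_powR => //; rewrite ler_pdivlMr ?mul1r// ltW.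
rewrite powRM ?invr_ge0 ?(ltW t0)// (_ : t^-1 `^ p = (t `^ p)^-1).
  by rewrite (_ : _ * (_ / _) = t / t `^ p * g `^ p) ?lerDr ?ltW//; ring.
apply: (mulIf tp0); rewrite mulVf// -powRM ?invr_ge0 ?(ltW t0)//.
by rewrite mulVf ?gt_eqF// powR1.
Qed.

Lemma boxC x y (d : R) : box x d y = box y d x.
Proof.
by rewrite /box/= (distrC y.1.1) (distrC y.1.2) (distrC y.2).
Qed.

Lemma measurable_boxrel (d : R) :
  measurable [set z : borel3 R * borel3 R | box z.1 d z.2].
Proof.
have m (f : borel3 R -> R) : measurable_fun setT f ->
    measurable [set z : borel3 R * borel3 R | `|f z.2 - f z.1| < d].
  move=> mf; have mg : measurable_fun setT (fun z : borel3 R * borel3 R => `|f z.2 - f z.1|).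
    by apply: measurableT_comp => //; apply: measurable_funB; exact: measurableT_comp.
  have := mg measurableT _ (measurable_itv `]-oo, d[).
  by rewrite setTI; congr measurable; apply/seteqP; split => z /=; rewrite in_itv.
have h i : measurable_fun setT (coord i : borel3 R -> R).
  by apply: continuous3_measurable_fun; exact: continuous_coord.
have := measurableI _ _ (m _ (h 0)) (measurableI _ _ (m _ (h 1)) (m _ (h 2))).
exact.
Qed.

(** The [n]-th term integrates to [4 (rho / 2^n)^-2 (2 rho / 2^n)^3 = 64 rho / 2^(n+1)], a geometric
    series. *)
Lemma integral_dyadic_kernel (rho : R) x : 0 < rho ->
  (\int[leb3 R]_y dyadic_kernel rho x y <= (64 * rho)%:E)%E.
Proof.
move=> rho0; rewrite /dyadic_kernel.
have mi n : measurable_fun setT (fun y : borel3 R =>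
    (4 * (rho / 2 ^+ n)^-1 ^+ 2 * \1_(box x (rho / 2 ^+ n)) y)%:E).
  apply/measurable_EFinP; apply: measurable_funM => //.
  by apply: measurable_indic; exact: measurable_box.
rewrite integral_nneseries//; last by move=> n y _; exact: dyadic_term_ge0.
apply: le_trans (epsilon_trick0 xpredT (_ : 0 <= 64 * rho)); last first.
  by rewrite mulr_ge0// ltW.
rewrite le_eqVlt; apply/orP; left; apply/eqP; apply: eq_eseriesr => n _.
have dn0 : 0 < rho / 2 ^+ n by rewrite divr_gt0// exprn_gt0.
have mb : measurable (box x (rho / 2 ^+ n) : set (borel3 R)) by exact: measurable_box.
rewrite (@integralZl_indic _ _ R (leb3 R) setT measurableT (fun=> box x (rho / 2 ^+ n)))//;
  last by rewrite ltNge mulr_ge0// sqr_ge0.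
rewrite integral_indic// setIT.
rewrite -[X in (_ * X)%E]/(leb3 R (box x (rho / 2 ^+ n))) leb3_box// -EFinM.
congr EFin; rewrite natrX [2 ^+ n.+1]exprS; have : 2 ^+ n != 0 :> R by rewrite expf_neq0.
by move: (2 ^+ n) => t t0; field; rewrite t0 gt_eqF.
Qed.


Lemma dyadic_kernelC (rho : R) x y : dyadic_kernel rho x y = dyadic_kernel rho y x.
Proof.
apply: eq_eseriesr => n _; rewrite !indicE.
by have -> : (y \in box x (rho / 2 ^+ n)) = (x \in box y (rho / 2 ^+ n))
  by apply/idP/idP; rewrite !inE boxC.
Qed.

Lemma measurable_dyadic_kernel2 (rho : R) :
  measurable_fun setT (fun z : borel3 R * borel3 R => dyadic_kernel rho z.1 z.2).
Proof.
apply: ge0_emeasurable_sum => [n z _ _|n _]; first exact: dyadic_term_ge0.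
apply/measurable_EFinP; apply: measurable_funM => //.
rewrite (_ : (fun z => _) = \1_[set z : borel3 R * borel3 R | box z.1 (rho / 2 ^+ n) z.2]).
  by apply: measurable_indic; exact: measurable_boxrel.
by apply/funext => z; rewrite !indicE; congr (_%:R); congr nat_of_bool; apply/idP/idP; rewrite !inE.
Qed.

(** The constants divide up the [lam / 8] of [local_estimate]. The mean takes [lam / 16], the level
    [tau] takes [3 * (lam / 96)], and the remainder forces [F >= 64 rho tau^p] wherever [lam < a].
    Chebyshev's inequality for [F] then meets the bound [64 rho] times the integral of [G^p], and
    the kernel mass cancels. *)
Lemma weak_type (a b c1 d G : R * R * R -> R) (p r lam rho : R) :
  C1_ball a -> C1_ball b -> C1_ball c1 -> C1_ball d ->
  measurable_fun setT (G : borel3 R -> R) ->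
  (forall y, `|partial 2 a y + partial 0 c1 y + partial 1 d y| <= G y) ->
  (forall y, `|partial 0 a y - partial 1 b y - partial 2 c1 y| <= G y) ->
  (forall y, `|partial 1 a y + partial 0 b y - partial 2 d y| <= G y) ->
  1 <= p -> 1 <= r -> 0 < rho -> 0 < lam ->
  (\int[leb3 R]_y (`|a y| `^ r)%:E <= (8 * rho ^+ 3 * (lam / 16 ^+ 3) `^ r)%:E)%E ->
  (((lam / (24 * 16 ^+ 2 * rho)) `^ p)%:E * leb3 R [set x | (lam < a x)%R]
    <= \int[leb3 R]_y (G y `^ p)%:E)%E.
Proof.
move=> ha hb hc hd mG hH0 hH1 hH2 p1 r1 rho0 lam0 hSr.
have G0 y : 0 <= G y by exact: le_trans (hH0 y).
have [ca _ _ a0 _] := ha.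
have ma : measurable_fun setT (a : borel3 R -> R) by exact: continuous3_measurable_fun.
have mna : measurable_fun setT (fun y : borel3 R => `|a y|) by exact: measurableT_comp.
set t := lam / 16 ^+ 3 in hSr *; set tau := lam / (24 * 16 ^+ 2 * rho).
have t0 : 0 < t by rewrite divr_gt0// exprn_gt0.
have tau0 : 0 < tau by rewrite divr_gt0// mulr_gt0// mulr_gt0// exprn_gt0.
have tr0 : 0 < t `^ r by exact: powR_gt0.
have taup0 : 0 < tau `^ p by exact: powR_gt0.
pose c := t / t `^ r; pose ctau := tau / tau `^ p.
have cpos : 0 < c by rewrite divr_gt0.
have ctau0 : 0 < ctau by rewrite divr_gt0.
pose K x y := dyadic_kernel rho x y.
have K0 x y : (0 <= K x y)%E by exact: dyadic_kernel_ge0.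
have mK x : measurable_fun setT (K x : borel3 R -> \bar R) by exact: measurable_dyadic_kernel.
have mGp : measurable_fun setT (fun y : borel3 R => (G y `^ p)%:E).
  apply/measurable_EFinP.
  exact: (@measurableT_comp _ _ _ _ _ _ (fun u : R => u `^ p)).
have mar : measurable_fun setT (fun y : borel3 R => (`|a y| `^ r)%:E).
  apply/measurable_EFinP.
  exact: (@measurableT_comp _ _ _ _ _ _ (fun u : R => u `^ r)).
have Gp0 y : (0 <= (G y `^ p)%:E)%E by rewrite lee_fin powR_ge0.
have ar0 y : (0 <= (`|a y| `^ r)%:E)%E by rewrite lee_fin powR_ge0.
have mKG x : measurable_fun setT (fun y : borel3 R => K x y * (G y `^ p)%:E)%E.
  exact: emeasurable_funM.
pose F (x : borel3 R) := (\int[leb3 R]_y (K x y * (G y `^ p)%:E))%E.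
have F0 x : (0 <= F x)%E by apply: integral_ge0 => y _; exact: mule_ge0.
have avg x : (\int[leb3 R]_(y in box x rho) `|a y|%:E <= (16 * rho ^+ 3 * t)%:E)%E.
  have mb : measurable (box x rho : set (borel3 R)) by exact: measurable_box.
  have mS (f : borel3 R -> \bar R) : measurable_fun setT f -> measurable_fun (box x rho : set (borel3 R)) f.
    exact: measurable_funS.
  apply: (@le_trans _ _ (\int[leb3 R]_(y in box x rho) (t%:E + c%:E * (`|a y| `^ r)%:E))%E).
    apply: ge0_le_integral => //.
    - by apply: mS; exact/measurable_EFinP.
    - by apply: mS; apply: emeasurable_funD => //; exact: emeasurable_funM.
    - by move=> y _; rewrite -EFinM -EFinD lee_fin; exact: le_add_powR.
  rewrite ge0_integralD//; first last.
  - by apply: mS; exact: emeasurable_funM.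
  - by move=> y _; rewrite mule_ge0// lee_fin ltW.
  - by move=> y _; rewrite lee_fin ltW.
  rewrite integral_cst// -[X in (t%:E * X)%E]/(leb3 R (box x rho)) leb3_box//.
  rewrite ge0_integralZl_EFin ?(ltW cpos)//; last exact: mS.
  apply: (@le_trans _ _ (t%:E * ((2 * rho) ^+ 3)%:E + c%:E * (8 * rho ^+ 3 * t `^ r)%:E)%E).
    apply: leeD => //; apply: lee_wpmul2l; first by rewrite lee_fin ltW.
    apply: le_trans hSr; exact: ge0_subset_integral.
  rewrite -!EFinM -EFinD lee_fin /c le_eqVlt; apply/orP; left; apply/eqP.
  by field; rewrite gt_eqF.
have drift x : (\int[leb3 R]_y (K x y * (G y)%:E) <= (64 * rho * tau)%:E + ctau%:E * F x)%E.
  apply: (@le_trans _ _ (\int[leb3 R]_y (tau%:E * K x y + ctau%:E * (K x y * (G y `^ p)%:E)))%E).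
    apply: ge0_le_integral => //.
    - by move=> y _; rewrite mule_ge0// lee_fin.
    - by apply: emeasurable_funM => //; exact/measurable_EFinP.
    - by apply: emeasurable_funD; exact: emeasurable_funM.
    - move=> y _; rewrite [X in (_ <= X + _)%E]muleC [X in (_ <= _ + X)%E]muleCA -ge0_muleDr//.
      + by rewrite lee_wpmul2l// -EFinM -EFinD lee_fin; exact: le_add_powR.
      + by rewrite lee_fin ltW.
      + by rewrite mule_ge0// lee_fin ltW.
  rewrite ge0_integralD//; first last.
  - exact: emeasurable_funM.
  - by move=> y _; rewrite mule_ge0 ?mule_ge0// lee_fin ltW.
  - exact: emeasurable_funM.
  - by move=> y _; rewrite mule_ge0// lee_fin ltW.
  rewrite (@ge0_integralZl_EFin _ _ R (leb3 R) _ _ (K x) _ _ tau) ?(ltW tau0)//.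
  rewrite (@ge0_integralZl_EFin _ _ R (leb3 R) _ _ (fun y => K x y * (G y `^ p)%:E)%E _ _ ctau)
    ?(ltW ctau0)//; last by move=> y _; exact: mule_ge0.
  rewrite (mulrC (64 * rho)); apply: leeD => //.
  rewrite [leRHS]EFinM.
  by apply: lee_wpmul2l; [rewrite lee_fin ltW|exact: integral_dyadic_kernel].
have EF x : lam < a x -> ((64 * rho * tau `^ p)%:E <= F x)%E.
  move=> lamx; have := local_estimate ha hb hc hd mG hH0 hH1 hH2 rho0 lam0 lamx.
  have [Fy|] := eqVneq (F x) +oo%E; first by rewrite Fy leey.
  move=> Fy; have Ffin : F x \is a fin_num by rewrite ge0_fin_numE// ltey.
  have r30 : 0 <= 16 * rho^-1 ^+ 3 by rewrite mulr_ge0// exprn_ge0// invr_ge0 ltW.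
  move=> H; have := drift x; move: Ffin; case: (F x) => [f||]// _ dr.
  rewrite lee_fin.
  have {H} : lam / 8 <= 16 * rho^-1 ^+ 3 * (16 * rho ^+ 3 * t) + 3 * (64 * rho * tau + ctau * f).
    rewrite -lee_fin; apply: le_trans H _.
    rewrite [leRHS]EFinD; apply: leeD; rewrite [leRHS]EFinM; apply: lee_wpmul2l => //.
  have -> : 16 * rho^-1 ^+ 3 * (16 * rho ^+ 3 * t) = lam / 16.
    by rewrite /t; field; rewrite gt_eqF.
  have -> : 64 * rho * tau = lam / 96 by rewrite /tau; field; rewrite gt_eqF.
  move=> h.
  have h2 : lam / 96 <= ctau * f by lra.
  have : lam / 96 / ctau <= f by rewrite ler_pdivrMr// (mulrC f).
  apply: le_trans; rewrite le_eqVlt; apply/orP; left; apply/eqP.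
  rewrite /ctau (_ : lam / 96 = 64 * rho * tau); last by rewrite /tau; field; rewrite gt_eqF.
  by field; rewrite !gt_eqF.
have mK2 : measurable_fun setT (fun z : borel3 R * borel3 R => K z.1 z.2 * (G z.2 `^ p)%:E)%E.
  apply: emeasurable_funM; first exact: measurable_dyadic_kernel2.
  exact: (@measurableT_comp _ _ _ _ _ _ (fun y : borel3 R => (G y `^ p)%:E)).
have KG0 (z : borel3 R * borel3 R) : (0 <= K z.1 z.2 * (G z.2 `^ p)%:E)%E by exact: mule_ge0.
have mF : measurable_fun setT F.
  exact: (@measurable_fun_fubini_tonelli_F _ _ _ _ R (leb3 R)
    (fun z : borel3 R * borel3 R => K z.1 z.2 * (G z.2 `^ p)%:E)%E mK2 KG0).
(* After exchanging the integrals, symmetry of the kernel makes the inner one its mass in the other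
   variable. *)
have intF : (\int[leb3 R]_x F x <= (64 * rho)%:E * \int[leb3 R]_y (G y `^ p)%:E)%E.
  rewrite [leLHS](@fubini_tonelli _ _ _ _ R (leb3 R) (leb3 R)
    (fun z : borel3 R * borel3 R => K z.1 z.2 * (G z.2 `^ p)%:E)%E mK2 KG0)/=.
  rewrite -ge0_integralZl_EFin//; last by rewrite mulr_ge0// ltW.
  have mKy y : measurable_fun setT (fun x : borel3 R => K x y).
    by rewrite /K; under eq_fun do rewrite dyadic_kernelC; exact: mK.
  apply: ge0_le_integral.
  - exact: measurableT.
  - by move=> y _; apply: integral_ge0 => x _; exact: mule_ge0.
  - exact: (@measurable_fun_fubini_tonelli_G _ _ _ _ R (leb3 R)
    (fun z : borel3 R * borel3 R => K z.1 z.2 * (G z.2 `^ p)%:E)%E mK2 KG0).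
  - by apply: emeasurable_funM; [exact: measurable_cst|exact: mGp].
  - move=> y _; under eq_integral do rewrite muleC.
    rewrite ge0_integralZl_EFin ?powR_ge0// muleC lee_wpmul2r//.
    by under eq_integral do rewrite /K dyadic_kernelC; exact: integral_dyadic_kernel.
have kap0 : 0 < 64 * rho * tau `^ p by rewrite mulr_gt0// mulr_gt0.
have := @le_integral_abse _ _ R (leb3 R) setT measurableT F _ mF kap0.
under eq_integral do rewrite gee0_abs//.
rewrite setTI; set S := [set x | _] => /le_trans/(_ intF).
rewrite [X in (X * _)%E](_ : _ = (64 * rho)%:E * (tau `^ p)%:E)%E; last exact: EFinM.
rewrite -muleA lee_pmul2l; [|by []|by rewrite lte_fin mulr_gt0].
apply: le_trans; apply: lee_wpmul2l; first by rewrite lee_fin ltW.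
apply: le_measure; rewrite ?inE.
- by have := ma measurableT _ (measurable_itv `]lam, +oo[); rewrite setTI;
    congr measurable; apply/seteqP; split => z /=; rewrite in_itv/= andbT.
- have := emeasurable_fun_c_infty measurableT mF (64 * rho * tau `^ p)%:E.
  by rewrite setTI; congr measurable; apply/seteqP; split => z; rewrite /S/= gee0_abs.
- by move=> x /= /EF; rewrite /S/= gee0_abs.
Qed.

End weak_type.

(** * Test functions *)

Section dirac_system.
Variable R : realType.
Implicit Types (a b c d u : R * R * R -> R) (x y : R * R * R).

Lemma C1_ball_opp u : C1_ball u -> C1_ball (fun x => - u x).
Proof.
move=> [cu cpu du u0 pu0].
have pN j y : partial j (fun x => - u x) y = - partial j u y.
  by rewrite /partial deriveN//; exact: du.
split.
- by move=> y; apply: cvgN; exact: cu.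
- move=> j; rewrite (_ : partial j _ = fun y => - partial j u y); last exact/funext.
  by move=> y; apply: cvgN; exact: cpu.
- by move=> j y; apply: derivableN; exact: du.
- by move=> y /u0 ->; rewrite oppr0.
- by move=> j y; rewrite pN => /pu0 ->; rewrite oppr0.
Qed.

Lemma partial_opp u j y : C1_ball u -> partial j (fun x => - u x) y = - partial j u y.
Proof. by move=> [_ _ du _ _]; rewrite /partial deriveN//; exact: du. Qed.

(* The real form of the bound [|sigma . grad psi| <= G] for the two-component
   spinor [psi = (a + ib, c + id)]. *)
Definition dirac_system (G a b c d : R * R * R -> R) :=
  [/\ C1_ball a, C1_ball b, C1_ball c, C1_ball d &
  forall y, [/\ `|partial 2 a y + partial 0 c y + partial 1 d y| <= G y,
    `|partial 2 b y + partial 0 d y - partial 1 c y| <= G y,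
    `|partial 0 a y - partial 1 b y - partial 2 c y| <= G y &
    `|partial 1 a y + partial 0 b y - partial 2 d y| <= G y]].

Lemma norm_le_eqN (u v g : R) : `|v| <= g -> u = - v -> `|u| <= g.
Proof. by move=> h ->; rewrite normrN. Qed.

Lemma norm_le_eq (u v g : R) : `|v| <= g -> u = v -> `|u| <= g.
Proof. by move=> h ->. Qed.

(* [psi] multiplied by [-i]. *)
Lemma dirac_system_rot G a b c d :
  dirac_system G a b c d -> dirac_system G b (\- a) d (\- c).
Proof.
move=> [ha hb hc hd H]; split; [exact: hb|exact: C1_ball_opp|exact: hd|exact: C1_ball_opp|move=> y].
have [h1 h2 h3 h4] := H y; rewrite !(partial_opp _ _ ha, partial_opp _ _ hc); split; [exact: h2|..].
- by apply: (norm_le_eqN h1); ring.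
- by apply: (norm_le_eq h4); ring.
- by apply: (norm_le_eqN h3); ring.
Qed.

(* The antiunitary map exchanging the two components of [psi]. *)
Lemma dirac_system_swap G a b c d :
  dirac_system G a b c d -> dirac_system G c (\- d) (\- a) b.
Proof.
move=> [ha hb hc hd H]; split; [exact: hc|exact: C1_ball_opp|exact: C1_ball_opp|exact: hb|move=> y].
have [h1 h2 h3 h4] := H y; rewrite !(partial_opp _ _ ha, partial_opp _ _ hd); split.
- by apply: (norm_le_eqN h3); ring.
- by apply: (norm_le_eq h4); ring.
- by apply: (norm_le_eq h1); ring.
- by apply: (norm_le_eqN h2); ring.
Qed.

(** Rotating twice multiplies the spinor by -1, so the one-sided estimate also holds for [- a]; the
    factor 2 counts the two signs. *)
Lemma dirac_system_weak_type G a b c d (p r lam rho : R) :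
  dirac_system G a b c d -> measurable_fun setT (G : borel3 R -> R) ->
  1 <= p -> 1 <= r -> 0 < rho -> 0 < lam ->
  (\int[leb3 R]_y (`|a y| `^ r)%:E <= (8 * rho ^+ 3 * (lam / 16 ^+ 3) `^ r)%:E)%E ->
  (((lam / (24 * 16 ^+ 2 * rho)) `^ p)%:E * leb3 R [set x | (lam < `|a x|)%R]
    <= 2%:E * \int[leb3 R]_y (G y `^ p)%:E)%E.
Proof.
move=> S mG p1 r1 rho0 lam0 h.
have W a' b' c' d' (S' : dirac_system G a' b' c' d') (e : forall y, `|a' y| = `|a y|) :
  (((lam / (24 * 16 ^+ 2 * rho)) `^ p)%:E * leb3 R [set x | (lam < a' x)%R]
    <= \int[leb3 R]_y (G y `^ p)%:E)%E.
  case: S' => ha hb hc hd H.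
  apply: (weak_type (r := r) ha hb hc hd mG _ _ _ p1 r1 rho0 lam0) => [y|y|y|].
  - by have [] := H y.
  - by have [] := H y.
  - by have [] := H y.
  - by under eq_integral do rewrite e.
have W1 := W _ _ _ _ S (fun=> erefl).
have W2 := W _ _ _ _ (dirac_system_rot (dirac_system_rot S)) (fun y => normrN (a y)).
have [ha _ _ _ _] := S; have [ca _ _ _ _] := ha.
have ma : measurable_fun setT (a : borel3 R -> R) by exact: continuous3_measurable_fun.
have m1 : measurable ([set x | lam < a x] : set (borel3 R)).
  have := ma measurableT _ (measurable_itv `]lam, +oo[); rewrite setTI.
  by congr measurable; apply/seteqP; split => z /=; rewrite in_itv/= andbT.
have m2 : measurable ([set x | lam < - a x] : set (borel3 R)).
  have := ma measurableT _ (measurable_itv `]-oo, - lam[); rewrite setTI.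
  by congr measurable; apply/seteqP; split => z /=; rewrite in_itv/= ltrNr.
have -> : [set x | lam < `|a x|] = [set x | lam < a x] `|` [set x | lam < - a x].
  apply/seteqP; split => z /=.
    by rewrite ltr_normr => /orP.
  by case => /lt_le_trans; apply; rewrite ?ler_norm// -normrN ler_norm.
rewrite -[2%R]/(1 + 1) EFinD ge0_muleDl// !mul1e.
apply: le_trans (leeD W1 W2); rewrite -ge0_muleDr ?lee_fin ?powR_ge0//.
apply: lee_wpmul2l; first by rewrite lee_fin powR_ge0.
exact: measureU2.
Qed.

End dirac_system.

(** * Coordinates of the Dirac operator and the level-set estimate for spinors *)

Section spinors.
Variable R : realType.
Implicit Types (phi f : R * R * R -> 'cV[R[i]]_4) (x y : R * R * R).

Lemma C1_ball_smooth (u : R * R * R -> R) (K : set (R * R * R)) : smooth u ->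
  compact K -> K `<=` unit_ball R -> (forall x, ~ K x -> u x = 0) -> C1_ball u.
Proof.
move=> su cK KB u0; split.
- by move=> x; apply: differentiable_continuous; exact: (su [::]).
- by move=> j x; apply: differentiable_continuous; exact: (su [:: j]).
- by move=> j x; apply: diff_derivable; exact: (su [::]).
- by move=> x nB; apply: u0 => /KB.
- move=> j x nB.
  have oK : open (~` K) by apply: closed_openC; apply: compact_closed => //; exact: norm_hausdorff.
  have nK : (~` K) x by move=> /KB.
  rewrite /partial (@near_eq_derive _ _ _ u (cst 0)) ?derive_cst//.
  by apply: filterS (open_nbhs_nbhs (conj oK nK)) => y /= /u0.
Qed.

Lemma spinor_norm_ge0 (v : 'cV[R[i]]_4) : 0 <= spinor_norm v.
Proof. exact: sqrtr_ge0. Qed.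

Lemma sqr_spinor_norm (v : 'cV[R[i]]_4) : spinor_norm v ^+ 2 =
  \sum_(a < 4) (complex.Re (v a 0) ^+ 2 + complex.Im (v a 0) ^+ 2).
Proof. by rewrite sqr_sqrtr// sumr_ge0// => a _; rewrite addr_ge0 ?sqr_ge0. Qed.

Lemma component_le_spinor_norm (v : 'cV[R[i]]_4) a :
  `|complex.Re (v a 0)| <= spinor_norm v /\ `|complex.Im (v a 0)| <= spinor_norm v.
Proof.
have H (t : R) : t ^+ 2 <= spinor_norm v ^+ 2 -> `|t| <= spinor_norm v.
  move=> h; rewrite -(@ler_pXn2r _ 2)// ?nnegrE ?spinor_norm_ge0//.
  by rewrite real_normK ?num_real.
have s0 : 0 <= \sum_(i < 4 | i != a) (complex.Re (v i 0) ^+ 2 + complex.Im (v i 0) ^+ 2).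
  by rewrite sumr_ge0// => i _; rewrite addr_ge0 ?sqr_ge0.
split; apply: H; rewrite sqr_spinor_norm (bigD1 a)//=.
  by rewrite -addrA lerDl addr_ge0// sqr_ge0.
by rewrite -addrA addrCA lerDl addr_ge0// sqr_ge0.
Qed.

(** There are eight real components; if all were at most [lam / 3], the squared norm would be at
    most [8 lam^2 / 9]. *)
Lemma spinor_norm_gt_component (v : 'cV[R[i]]_4) (lam : R) : 0 < lam -> lam < spinor_norm v ->
  exists a, lam / 3 < `|complex.Re (v a 0)| \/ lam / 3 < `|complex.Im (v a 0)|.
Proof.
move=> lam0 h; apply: contrapT => /forallNP H.
have {}H a : complex.Re (v a 0) ^+ 2 <= lam ^+ 2 / 9 /\ complex.Im (v a 0) ^+ 2 <= lam ^+ 2 / 9.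
  have /not_orP[h1 h2] := H a.
  have E : lam ^+ 2 / 9 = (lam / 3) ^+ 2 by field.
  by rewrite E -(real_normK (num_real (complex.Re _))) -(real_normK (num_real (complex.Im _)));
    rewrite !ler_pXn2r// ?nnegrE ?divr_ge0 ?(ltW lam0)//;
    split; rewrite leNgt; apply/negP.
have : spinor_norm v ^+ 2 <= lam ^+ 2 * (8 / 9).
  rewrite sqr_spinor_norm (_ : _ * _ = \sum_(a < 4) (lam ^+ 2 / 9 + lam ^+ 2 / 9)).
    by apply: ler_sum => a _; have [h1 h2] := H a; exact: lerD.
  by rewrite sumr_const card_ord -mulr_natr; field.
have : lam ^+ 2 < spinor_norm v ^+ 2 by rewrite ltr_pXn2r// nnegrE ltW// (lt_trans lam0).
have : 0 < lam ^+ 2 by rewrite exprn_gt0.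
lra.
Qed.

Lemma dirac_matrix_mulE (j : 'I_3) (v : 'cV[R[i]]_4) :
  dirac_matrix R j *m v = col_mx (pauli R j *m dsubmx (v : 'cV_(2 + 2))) (pauli R j *m usubmx (v : 'cV_(2 + 2))).
Proof.
rewrite /dirac_matrix -{1}[v](@vsubmxK _ 2 2).
by rewrite (@mul_block_col _ 2 2 2 2 1) !mul0mx add0r addr0.
Qed.

Lemma pauli_mulE (j : 'I_3) (w : 'cV[R[i]]_2) :
  (pauli R j *m w) 0 0 = (if j == 0 then w 1 0 else if j == 1 then - 'i * w 1 0 else w 0 0)
  /\ (pauli R j *m w) 1 0 = (if j == 0 then w 0 0 else if j == 1 then 'i * w 0 0 else - w 1 0).
Proof.
rewrite !mxE !big_ord_recl !big_ord0 !mxE.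
have -> : lift ord0 ord0 = 1 :> 'I_2 by apply/val_inj.
by elim/ord3_ind: j => /=; rewrite !(mul1r, mul0r, addr0, add0r, mulN1r).
Qed.

Lemma pauli_sumE (w0 w1 w2 : 'cV[R[i]]_2) :
  (pauli R 0 *m w0) 0 0 + (pauli R 1 *m w1) 0 0 + (pauli R 2 *m w2) 0 0 =
    w0 1 0 - 'i * w1 1 0 + w2 0 0 /\
  (pauli R 0 *m w0) 1 0 + (pauli R 1 *m w1) 1 0 + (pauli R 2 *m w2) 1 0 =
    w0 0 0 + 'i * w1 0 0 - w2 1 0.
Proof.
split; first by rewrite (pauli_mulE 0 _).1 (pauli_mulE 1 _).1 (pauli_mulE 2 _).1 /= mulNr.
by rewrite (pauli_mulE 0 _).2 (pauli_mulE 1 _).2 (pauli_mulE 2 _).2.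
Qed.

(** [sigma . grad] of a two-component spinor whose components have gradients [u] and [v]. *)
Definition pauli_grad (u v : 'I_3 -> R[i]) : R[i] * R[i] :=
  (v 0 - 'i * v 1 + u 2, u 0 + 'i * u 1 - v 2).

(** The Dirac matrices are block off-diagonal: the upper half of the result depends on the lower
    half of the spinor only, and conversely. *)
Lemma dirac_sumE (D : 'I_3 -> 'cV[R[i]]_4) :
  let d k j := D j k 0 in
  let u (k : 'I_2) : 'I_4 := @lshift 2 2 k in let l (k : 'I_2) : 'I_4 := @rshift 2 2 k in
  let h := \sum_(j < 3) dirac_matrix R j *m D j in
  [/\ h (u 0) 0 = (pauli_grad (d (l 0)) (d (l 1))).1,
      h (u 1) 0 = (pauli_grad (d (l 0)) (d (l 1))).2,
      h (l 0) 0 = (pauli_grad (d (u 0)) (d (u 1))).1 &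
      h (l 1) 0 = (pauli_grad (d (u 0)) (d (u 1))).2].
Proof.
move=> d u l h.
have up k (j : 'I_3) w : (dirac_matrix R j *m w) (u k) 0 = (pauli R j *m dsubmx (w : 'cV_(2 + 2))) k 0.
  by rewrite dirac_matrix_mulE; exact: col_mxEu.
have lo k (j : 'I_3) w : (dirac_matrix R j *m w) (l k) 0 = (pauli R j *m usubmx (w : 'cV_(2 + 2))) k 0.
  by rewrite dirac_matrix_mulE; exact: col_mxEd.
have dE k w : dsubmx (w : 'cV[R[i]]_(2 + 2)) k 0 = w (l k) 0 by rewrite mxE.
have uE k w : usubmx (w : 'cV[R[i]]_(2 + 2)) k 0 = w (u k) 0 by rewrite mxE.
have S3 k : h k 0 = (dirac_matrix R 0 *m D 0) k 0 + (dirac_matrix R 1 *m D 1) k 0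
    + (dirac_matrix R 2 *m D 2) k 0.
  rewrite /h summxE !big_ord_recr big_ord0 /= add0r.
  by congr (_ + _ + _); congr ((dirac_matrix R _ *m D _) k 0); exact/val_inj.
have [p0 p1] := pauli_sumE (dsubmx (D 0 : 'cV_(2 + 2))) (dsubmx (D 1 : 'cV_(2 + 2)))
  (dsubmx (D 2 : 'cV_(2 + 2))).
have [q0 q1] := pauli_sumE (usubmx (D 0 : 'cV_(2 + 2))) (usubmx (D 1 : 'cV_(2 + 2)))
  (usubmx (D 2 : 'cV_(2 + 2))).
rewrite !dE in p0 p1; rewrite !uE in q0 q1.
by split; rewrite S3 ?up ?lo ?p0 ?p1 ?q0 ?q1.
Qed.

Lemma dirac_opE phi x :
  let d k j := spinor_partial j phi x k 0 in
  let u (k : 'I_2) : 'I_4 := @lshift 2 2 k in let l (k : 'I_2) : 'I_4 := @rshift 2 2 k in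
  [/\ dirac_op phi x (u 0) 0 = - 'i * (pauli_grad (d (l 0)) (d (l 1))).1,
      dirac_op phi x (u 1) 0 = - 'i * (pauli_grad (d (l 0)) (d (l 1))).2,
      dirac_op phi x (l 0) 0 = - 'i * (pauli_grad (d (u 0)) (d (u 1))).1 &
      dirac_op phi x (l 1) 0 = - 'i * (pauli_grad (d (u 0)) (d (u 1))).2].
Proof.
move=> d u l; have [e0 e1 e2 e3] := dirac_sumE (fun j => spinor_partial j phi x).
by rewrite /dirac_op; split; rewrite mxE ?e0 ?e1 ?e2 ?e3.
Qed.

Lemma Re_mulNi (z : R[i]) : complex.Re (- 'i * z) = complex.Im z.
Proof. by case: z => a b; rewrite -complexiE; simpc. Qed.

Lemma Im_mulNi (z : R[i]) : complex.Im (- 'i * z) = - complex.Re z.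
Proof. by case: z => a b; rewrite -complexiE; simpc. Qed.

Lemma pauli_gradE (ur ui vr vi : 'I_3 -> R) :
  pauli_grad (fun j => ur j +i* ui j)%C (fun j => vr j +i* vi j)%C =
  ((vr 0 + vi 1 + ur 2) +i* (vi 0 - vr 1 + ui 2),
   (ur 0 - ui 1 - vr 2) +i* (ui 0 + ur 1 - vi 2))%C.
Proof. by rewrite /pauli_grad -complexiE; congr pair; simpc. Qed.

Lemma measurable_spinor_norm (D : set (borel3 R)) f : measurable D ->
  (forall a, measurable_fun D (re_part f a : borel3 R -> R)) ->
  (forall a, measurable_fun D (im_part f a : borel3 R -> R)) ->
  measurable_fun D (fun x : borel3 R => spinor_norm (f x)).
Proof.
move=> mD mr mi; rewrite /spinor_norm.
apply: (@measurableT_comp _ _ _ _ _ _ (@Num.sqrt R)).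
  exact: continuous_measurable_fun (@sqrt_continuous R).
apply: (@measurable_sum _ _ _ _ _ _ (fun a x => complex.Re (f x a 0) ^+ 2 + complex.Im (f x a 0) ^+ 2)) => a.
by apply: measurable_funD; apply: measurable_funX; [exact: mr|exact: mi].
Qed.

Lemma ord4_ind (P : 'I_4 -> Prop) : P (@lshift 2 2 0) -> P (@lshift 2 2 1) ->
  P (@rshift 2 2 0) -> P (@rshift 2 2 1) -> forall i, P i.
Proof.
move=> P0 P1 P2 P3 -[[|[|[|[|//]]]] i4].
- by rewrite (_ : Ordinal i4 = @lshift 2 2 0)//; exact/val_inj.
- by rewrite (_ : Ordinal i4 = @lshift 2 2 1)//; exact/val_inj.
- by rewrite (_ : Ordinal i4 = @rshift 2 2 0)//; exact/val_inj.
- by rewrite (_ : Ordinal i4 = @rshift 2 2 1)//; exact/val_inj.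
Qed.

Lemma test_function_C1 phi a : test_function phi ->
  C1_ball (re_part phi a) /\ C1_ball (im_part phi a).
Proof.
move=> [sm [K [cK KB K0]]]; have [sr si] := sm a.
by split; [apply: (C1_ball_smooth sr cK KB)|apply: (C1_ball_smooth si cK KB)] => x /K0 e;
  rewrite /re_part /im_part e mxE.
Qed.

Local Notation re := re_part.
Local Notation im := im_part.

Lemma dirac_op_components phi x :
  let u (k : 'I_2) : 'I_4 := @lshift 2 2 k in let l (k : 'I_2) : 'I_4 := @rshift 2 2 k in
  let h (s t : 'I_4) := ((partial 0 (re phi t) x + partial 1 (im phi t) x + partial 2 (re phi s) x,
     partial 0 (im phi t) x - partial 1 (re phi t) x + partial 2 (im phi s) x),
    (partial 0 (re phi s) x - partial 1 (im phi s) x - partial 2 (re phi t) x,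
     partial 0 (im phi s) x + partial 1 (re phi s) x - partial 2 (im phi t) x)) in
  let P a (w : R * R) := complex.Re (dirac_op phi x a 0) = w.2 /\
                         complex.Im (dirac_op phi x a 0) = - w.1 in
  [/\ P (u 0) (h (l 0) (l 1)).1, P (u 1) (h (l 0) (l 1)).2,
      P (l 0) (h (u 0) (u 1)).1 & P (l 1) (h (u 0) (u 1)).2].
Proof.
move=> u l h P; have [e0 e1 e2 e3] := dirac_opE phi x.
have E s t : pauli_grad (fun j => spinor_partial j phi x s 0) (fun j => spinor_partial j phi x t 0) =
   (((h s t).1.1 +i* (h s t).1.2), ((h s t).2.1 +i* (h s t).2.2))%C.
  by under eq_fun do rewrite mxE; under [X in pauli_grad _ X]eq_fun do rewrite mxE; rewrite pauli_gradE.
by rewrite /P; split; rewrite ?(e0, e1, e2, e3) Re_mulNi Im_mulNi E.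
Qed.

(* Weaker than [test_function], so as to cover [dirac_op phi] as well. *)
Definition ball_spinor h := (forall a, continuous (re h a) /\ continuous (im h a)) /\
  forall x, ~ unit_ball R x -> h x = 0.

Lemma test_ball_spinor phi : test_function phi -> ball_spinor phi.
Proof.
move=> tphi; split => [a|x nB].
  by have [[? _ _ _ _] [? _ _ _ _]] := test_function_C1 a tphi.
have [_ [K [_ KB K0]]] := tphi; by apply: K0 => /KB.
Qed.

Lemma dirac_ball_spinor phi : test_function phi -> ball_spinor (dirac_op phi).
Proof.
move=> tphi; have C1 a := test_function_C1 a tphi.
split; last first.
  move=> x nB; rewrite /dirac_op big1 ?scaler0// => j _.
  rewrite (_ : spinor_partial j phi x = 0) ?mulmx0//.
  apply/matrixP => a b; rewrite !mxE.
  have [[_ _ _ _ r0] [_ _ _ _ i0]] := C1 a.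
  by rewrite r0// i0.
have cr j a : continuous (partial j (re phi a)) by have [[_ h _ _ _] _] := C1 a; exact: h.
have ci j a : continuous (partial j (im phi a)) by have [_ [_ h _ _ _]] := C1 a; exact: h.
have cB (f g : R * R * R -> R) : continuous f -> continuous g -> continuous (fun x => f x - g x).
  by move=> cf cg x; apply: cvgB; [exact: cf|exact: cg].
have cD (f g : R * R * R -> R) : continuous f -> continuous g -> continuous (fun x => f x + g x).
  by move=> cf cg x; apply: cvgD; [exact: cf|exact: cg].
have cN (f : R * R * R -> R) : continuous f -> continuous (fun x => - f x).
  by move=> cf x; apply: cvgN; exact: cf.
have E x := dirac_op_components phi x.
have CE (f g : R * R * R -> R) : (forall x, f x = g x) -> continuous g -> continuous f.
  by move=> /funext ->.
move=> a; split; move: a.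
- elim/ord4_ind; rewrite /re_part.
  + eapply CE; first by move=> x; have [[h _] _ _ _] := E x; exact: h.
    exact: (cD _ _ (cB _ _ (ci _ _) (cr _ _)) (ci _ _)).
  + eapply CE; first by move=> x; have [_ [h _] _ _] := E x; exact: h.
    exact: (cB _ _ (cD _ _ (ci _ _) (cr _ _)) (ci _ _)).
  + eapply CE; first by move=> x; have [_ _ [h _] _] := E x; exact: h.
    exact: (cD _ _ (cB _ _ (ci _ _) (cr _ _)) (ci _ _)).
  + eapply CE; first by move=> x; have [_ _ _ [h _]] := E x; exact: h.
    exact: (cB _ _ (cD _ _ (ci _ _) (cr _ _)) (ci _ _)).
- elim/ord4_ind; rewrite /im_part.
  + eapply CE; first by move=> x; have [[_ h] _ _ _] := E x; exact: h.
    exact: (cN _ (cD _ _ (cD _ _ (cr _ _) (ci _ _)) (cr _ _))).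
  + eapply CE; first by move=> x; have [_ [_ h] _ _] := E x; exact: h.
    exact: (cN _ (cB _ _ (cB _ _ (cr _ _) (ci _ _)) (cr _ _))).
  + eapply CE; first by move=> x; have [_ _ [_ h] _] := E x; exact: h.
    exact: (cN _ (cD _ _ (cD _ _ (cr _ _) (ci _ _)) (cr _ _))).
  + eapply CE; first by move=> x; have [_ _ _ [_ h]] := E x; exact: h.
    exact: (cN _ (cB _ _ (cB _ _ (cr _ _) (ci _ _)) (cr _ _))).
Qed.

Lemma ball_spinor_measurable h : ball_spinor h ->
  (forall a, measurable_fun setT (re h a : borel3 R -> R)) /\
  (forall a, measurable_fun setT (im h a : borel3 R -> R)).
Proof.
by move=> [ch _]; split=> a; apply: continuous3_measurable_fun; have [] := ch a.
Qed.

Lemma measurable_ball_spinor h : ball_spinor h ->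
  measurable_fun setT (fun x : borel3 R => spinor_norm (h x)).
Proof. by move=> /ball_spinor_measurable[mr mi]; exact: measurable_spinor_norm. Qed.

Lemma ball_spinor_bounded h : ball_spinor h -> exists2 C, 0 <= C & forall x, spinor_norm (h x) <= C.
Proof.
move=> [ch h0].
have B a : exists C, forall x, `|re h a x| <= C /\ `|im h a x| <= C.
  have [cr ci] := ch a.
  have [|C1 _ H1] := continuous_ball_bounded cr; first by move=> x /h0 e; rewrite /re_part e mxE.
  have [|C2 _ H2] := continuous_ball_bounded ci; first by move=> x /h0 e; rewrite /im_part e mxE.
  by exists (Num.max C1 C2) => x; rewrite !le_max H1 H2 orbT.
have {B}/choice[C HC] := B.
exists (Num.sqrt (\sum_(a < 4) (C a ^+ 2 + C a ^+ 2))); first exact: sqrtr_ge0.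
move=> x; apply: ler_wsqrtr; apply: ler_sum => a _.
have sq (t c : R) : `|t| <= c -> t ^+ 2 <= c ^+ 2.
  by move=> tc; rewrite -real_normK ?num_real// ler_pXn2r// nnegrE (le_trans _ tc).
by have [h1 h2] := HC a x; apply: lerD; exact: sq.
Qed.

(** Up to the factor [- 'i], [sigma . grad] of one half of [phi] is the opposite half of
    [dirac_op phi], whose real components are bounded by the full norm. *)
Lemma test_dirac_system phi : test_function phi ->
  let S (s t : 'I_4) := dirac_system (fun x => spinor_norm (dirac_op phi x))
    (re phi s) (im phi s) (re phi t) (im phi t) in
  S (@lshift 2 2 0) (@lshift 2 2 1) /\ S (@rshift 2 2 0) (@rshift 2 2 1).
Proof.
move=> tphi S; have C1 a := test_function_C1 a tphi.
have E x := dirac_op_components phi x.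
have B x a := component_le_spinor_norm (dirac_op phi x) a.
split; split; try exact: (C1 _).1; try exact: (C1 _).2; move=> y.
- have [_ _ [h1 h2] [h3 h4]] := E y; split.
  + by apply: (norm_le_eqN (B y (@rshift 2 2 0)).2); rewrite h2 opprK/=; ring.
  + by apply: (norm_le_eq (B y (@rshift 2 2 0)).1); rewrite h1/=; ring.
  + by apply: (norm_le_eqN (B y (@rshift 2 2 1)).2); rewrite h4 opprK/=; ring.
  + by apply: (norm_le_eq (B y (@rshift 2 2 1)).1); rewrite h3/=; ring.
- have [[h1 h2] [h3 h4] _ _] := E y; split.
  + by apply: (norm_le_eqN (B y (@lshift 2 2 0)).2); rewrite h2 opprK/=; ring.
  + by apply: (norm_le_eq (B y (@lshift 2 2 0)).1); rewrite h1/=; ring.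
  + by apply: (norm_le_eqN (B y (@lshift 2 2 1)).2); rewrite h4 opprK/=; ring.
  + by apply: (norm_le_eq (B y (@lshift 2 2 1)).1); rewrite h3/=; ring.
Qed.

Lemma le_measureU_mul (k m n : R) (B : \bar R) (X Y : set (borel3 R)) :
  0 <= k -> 0 <= m -> 0 <= n -> measurable X -> measurable Y ->
  (k%:E * leb3 R X <= m%:E * B)%E -> (k%:E * leb3 R Y <= n%:E * B)%E ->
  (k%:E * leb3 R (X `|` Y) <= (m + n)%:E * B)%E.
Proof.
move=> k0 m0 n0 mX mY hX hY; rewrite EFinD ge0_muleDl ?lee_fin//.
apply: le_trans (leeD hX hY); rewrite -ge0_muleDr//.
by apply: lee_wpmul2l; [rewrite lee_fin|exact: measureU2].
Qed.

Lemma component_weak_type phi a (p r lam rho : R) : test_function phi ->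
  1 <= p -> 1 <= r -> 0 < rho -> 0 < lam ->
  (\int[leb3 R]_y (spinor_norm (phi y) `^ r)%:E <= (8 * rho ^+ 3 * (lam / 16 ^+ 3) `^ r)%:E)%E ->
  (((lam / (24 * 16 ^+ 2 * rho)) `^ p)%:E * leb3 R [set x | (lam < `|re phi a x|)%R]
    <= 2%:E * \int[leb3 R]_y (spinor_norm (dirac_op phi y) `^ p)%:E)%E /\
  (((lam / (24 * 16 ^+ 2 * rho)) `^ p)%:E * leb3 R [set x | (lam < `|im phi a x|)%R]
    <= 2%:E * \int[leb3 R]_y (spinor_norm (dirac_op phi y) `^ p)%:E)%E.
Proof.
move=> tphi p1 r1 rho0 lam0 h.
have C1 b := test_function_C1 b tphi.
have mphi := measurable_ball_spinor (test_ball_spinor tphi).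
have mG := measurable_ball_spinor (dirac_ball_spinor tphi).
pose P (u : R * R * R -> R) := (((lam / (24 * 16 ^+ 2 * rho)) `^ p)%:E * leb3 R [set x | (lam < `|u x|)%R]
    <= 2%:E * \int[leb3 R]_y (spinor_norm (dirac_op phi y) `^ p)%:E)%E.
have W (u v b c d : R * R * R -> R) : dirac_system (fun x => spinor_norm (dirac_op phi x)) u b c d ->
    continuous u -> (forall y, `|u y| = `|v y|) -> (forall y, `|v y| <= spinor_norm (phi y)) -> P v.
  move=> S cu uv vphi; rewrite /P; under eq_set do rewrite -uv.
  apply: (dirac_system_weak_type (r := r) S mG p1 r1 rho0 lam0).
  apply: le_trans h; apply: ge0_le_integral.
  - exact: measurableT.
  - by move=> y _; rewrite lee_fin powR_ge0.
  - apply/measurable_EFinP; apply: (@measurableT_comp _ _ _ _ _ _ (fun t : R => t `^ r)) => //.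
    by apply: measurableT_comp => //; exact: continuous3_measurable_fun.
  - by apply/measurable_EFinP; exact: (@measurableT_comp _ _ _ _ _ _ (fun t : R => t `^ r)).
  - move=> y _; rewrite lee_fin ge0_ler_powR ?nnegrE ?spinor_norm_ge0 ?(le_trans ler01 r1)//.
    by rewrite uv.
have [Su Sl] := test_dirac_system tphi.
have bre y b : `|re phi b y| <= spinor_norm (phi y) by exact: (component_le_spinor_norm _ _).1.
have bim y b : `|im phi b y| <= spinor_norm (phi y) by exact: (component_le_spinor_norm _ _).2.
have cre b : continuous (re phi b) by have [[]] := C1 b.
have cim b : continuous (im phi b) by have [_ []] := C1 b.
have cN u : continuous u -> continuous (\- u : R * R * R -> R) by move=> cu y; apply: cvgN; exact: cu.
rewrite -!/(P _).
(* The four real components of a half are reached by the identity, the rotation, the swap, and the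
   swap followed by the rotation; the last one arrives with a minus sign. *)
have H s t : dirac_system (fun x => spinor_norm (dirac_op phi x))
    (re phi s) (im phi s) (re phi t) (im phi t) ->
    (P (re phi s) /\ P (im phi s)) /\ (P (re phi t) /\ P (im phi t)).
  move=> S; split; split.
  - by apply: (W _ _ _ _ _ S) => //.
  - by apply: (W _ _ _ _ _ (dirac_system_rot S)).
  - by apply: (W _ _ _ _ _ (dirac_system_swap S)).
  - by apply: (W _ _ _ _ _ (dirac_system_rot (dirac_system_swap S))) => //; [exact: cN|move=> y; exact: normrN].
elim/ord4_ind: a; [exact: (H _ _ Su).1|exact: (H _ _ Su).2|exact: (H _ _ Sl).1|exact: (H _ _ Sl).2].
Qed.

(** The 16 is eight real components times the factor 2 of each. *)
Lemma test_weak_type phi (p r lam rho : R) : test_function phi ->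
  1 <= p -> 1 <= r -> 0 < rho -> 0 < lam ->
  (\int[leb3 R]_y (spinor_norm (phi y) `^ r)%:E <= (8 * rho ^+ 3 * (lam / 3 / 16 ^+ 3) `^ r)%:E)%E ->
  (((lam / 3 / (24 * 16 ^+ 2 * rho)) `^ p)%:E * leb3 R [set x | (lam < spinor_norm (phi x))%R]
    <= 16%:E * \int[leb3 R]_y (spinor_norm (dirac_op phi y) `^ p)%:E)%E.
Proof.
move=> tphi p1 r1 rho0 lam0 h.
have l30 : 0 < lam / 3 by rewrite divr_gt0.
have C1 b := test_function_C1 b tphi.
have H a := component_weak_type a tphi p1 r1 rho0 l30 h.
set k := (_ `^ p) in H *; set B := (\int[_]_y _)%E in H *.
have k0 : 0 <= k by exact: powR_ge0.
have mset (u : R * R * R -> R) : continuous u -> measurable ([set x | lam / 3 < `|u x|] : set (borel3 R)).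
  move=> cu; have mu : measurable_fun setT (fun x : borel3 R => `|u x|).
    by apply: measurableT_comp => //; exact: continuous3_measurable_fun.
  have := mu measurableT _ (measurable_itv `]lam / 3, +oo[); rewrite setTI.
  by congr measurable; apply/seteqP; split => z /=; rewrite in_itv/= andbT.
have mre a : measurable ([set x | lam / 3 < `|re phi a x|] : set (borel3 R)).
  by apply: mset; have [[]] := C1 a.
have mim a : measurable ([set x | lam / 3 < `|im phi a x|] : set (borel3 R)).
  by apply: mset; have [_ []] := C1 a.
pose Z a := [set x | lam / 3 < `|re phi a x|] `|` [set x | lam / 3 < `|im phi a x|].
have mZ a : measurable (Z a : set (borel3 R)) by exact: measurableU.
have HZ a : (k%:E * leb3 R (Z a) <= (2 + 2)%:E * B)%E.
  by apply: le_measureU_mul => //; [exact: (H a).1|exact: (H a).2].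
pose A0 := Z (@lshift 2 2 0) `|` Z (@lshift 2 2 1); pose A1 := Z (@rshift 2 2 0) `|` Z (@rshift 2 2 1).
have mA0 : measurable (A0 : set (borel3 R)) by exact: measurableU.
have mA1 : measurable (A1 : set (borel3 R)) by exact: measurableU.
have n4 : 0 <= 2 + 2 :> R by rewrite addr_ge0.
have n8 : 0 <= (2 + 2) + (2 + 2) :> R by rewrite addr_ge0.
have HA0 : (k%:E * leb3 R A0 <= (2 + 2 + (2 + 2))%:E * B)%E by exact: le_measureU_mul.
have HA1 : (k%:E * leb3 R A1 <= (2 + 2 + (2 + 2))%:E * B)%E by exact: le_measureU_mul.
rewrite (_ : 16%:E = (2 + 2 + (2 + 2) + (2 + 2 + (2 + 2)))%:E :> \bar R); last by congr EFin; ring.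
apply: le_trans (le_measureU_mul k0 n8 n8 mA0 mA1 HA0 HA1).
apply: lee_wpmul2l; first by rewrite lee_fin.
apply: le_measure; rewrite ?inE.
- have mphi := measurable_ball_spinor (test_ball_spinor tphi).
  have := mphi measurableT _ (measurable_itv `]lam, +oo[); rewrite setTI.
  by congr measurable; apply/seteqP; split => z /=; rewrite in_itv/= andbT.
- exact: measurableU.
move=> x /= /(spinor_norm_gt_component lam0)[a ha].
have {ha} : Z a x by case: ha => ?; [left|right].
by elim/ord4_ind: a => ?; [left; left|left; right|right; left|right; right].
Qed.

End spinors.

(** * Passage to the closure and interpolation *)

Section moments.
Variable R : realType.
Implicit Types (f g h u v w : R * R * R -> 'cV[R[i]]_4).

Definition ball_moment (s : R) h : \bar R :=
  (\int[leb3 R]_(x in unit_ball R) (spinor_norm (h x) `^ s)%:E)%E.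

Lemma measurable_unit_ball : measurable (unit_ball R : set (borel3 R)).
Proof.
have m : measurable_fun setT (fun x : borel3 R => x.1.1 ^+ 2 + x.1.2 ^+ 2 + x.2 ^+ 2).
  have mc i : measurable_fun setT (coord i : borel3 R -> R).
    by apply: continuous3_measurable_fun; exact: continuous_coord.
  apply: measurable_funD; first apply: measurable_funD; apply: measurable_funX.
  - exact: (mc 0).
  - exact: (mc 1).
  - exact: (mc 2).
have := m measurableT _ (measurable_itv `]-oo, 1[); rewrite setTI.
by congr measurable; apply/seteqP; split => z /=; rewrite in_itv.
Qed.
Let mB := measurable_unit_ball.

Lemma leb3_unit_ball : (leb3 R (unit_ball R) <= 8%:E)%E.
Proof.
rewrite -[leRHS](_ : leb3 R (box 0%R 1%R) = _); last first.
  by rewrite leb3_box//; congr EFin; ring.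
by apply: le_measure; rewrite ?inE//; [exact: measurable_box|exact: unit_ball_box].
Qed.

(** Twice the maximum, rather than the sum, suits powers with any nonnegative exponent and splits
    superlevel sets. Both signs occur, since approximants are compared with their limits in both
    directions. *)
Lemma spinor_norm_le_max (w u v : 'cV[R[i]]_4) :
  w = u + v \/ w = u - v -> spinor_norm w <= 2 * Num.max (spinor_norm u) (spinor_norm v).
Proof.
move=> huv.
have M0 : 0 <= Num.max (spinor_norm u) (spinor_norm v) by rewrite le_max spinor_norm_ge0.
rewrite -(@ler_pXn2r _ 2)// ?nnegrE ?mulr_ge0 ?spinor_norm_ge0//.
have h : spinor_norm w ^+ 2 <= 2 * spinor_norm u ^+ 2 + 2 * spinor_norm v ^+ 2.
  rewrite !sqr_spinor_norm 2!mulr_sumr -big_split; apply: ler_sum => a _ /=.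
  have sq (x y : R) : (x + y) ^+ 2 <= 2 * x ^+ 2 + 2 * y ^+ 2.
    by rewrite -subr_ge0 (_ : _ - _ = (x - y) ^+ 2) ?sqr_ge0//; ring.
  have sqB (x y : R) : (x - y) ^+ 2 <= 2 * x ^+ 2 + 2 * y ^+ 2.
    by rewrite (le_trans (sq _ _))// sqrrN.
  case: huv => ->; rewrite !mxE.
    case: (u a 0) (v a 0) => a1 a2 [b1 b2]/=.
    by have := sq a1 b1; have := sq a2 b2; lra.
  case: (u a 0) (v a 0) => a1 a2 [b1 b2]/=.
  by have := sqB a1 b1; have := sqB a2 b2; lra.
apply: (le_trans h).
have hu : spinor_norm u ^+ 2 <= Num.max (spinor_norm u) (spinor_norm v) ^+ 2.
  by rewrite ler_pXn2r// ?nnegrE ?spinor_norm_ge0// le_max lexx.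
have hv : spinor_norm v ^+ 2 <= Num.max (spinor_norm u) (spinor_norm v) ^+ 2.
  by rewrite ler_pXn2r// ?nnegrE ?spinor_norm_ge0// le_max lexx orbT.
by rewrite exprMn; lra.
Qed.

Lemma powR_spinor_norm_le (w u v : 'cV[R[i]]_4) (s : R) : 0 <= s ->
  w = u + v \/ w = u - v ->
  spinor_norm w `^ s <= 2 `^ s * (spinor_norm u `^ s + spinor_norm v `^ s).
Proof.
move=> s0 /spinor_norm_le_max h.
have M0 : 0 <= Num.max (spinor_norm u) (spinor_norm v) by rewrite le_max spinor_norm_ge0.
apply: (@le_trans _ _ ((2 * Num.max (spinor_norm u) (spinor_norm v)) `^ s)).
  by rewrite ge0_ler_powR// ?nnegrE ?spinor_norm_ge0// mulr_ge0.
rewrite powRM// ler_wpM2l ?powR_ge0// /Num.max; case: ifP => _.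
  by rewrite lerDr powR_ge0.
by rewrite lerDl powR_ge0.
Qed.

Definition norm_measurable h :=
  measurable_fun (unit_ball R : set (borel3 R)) (fun x : borel3 R => spinor_norm (h x)).

Lemma measurable_powR_norm h (s : R) : norm_measurable h ->
  measurable_fun (unit_ball R : set (borel3 R)) (fun x : borel3 R => (spinor_norm (h x) `^ s)%:E).
Proof.
by move=> mh; apply/measurable_EFinP; exact: (@measurableT_comp _ _ _ _ _ _ (fun t : R => t `^ s)).
Qed.

Lemma spinor_norm_measurable f : spinor_measurable f -> norm_measurable f.
Proof. by move=> mf; apply: measurable_spinor_norm => // a; have [] := mf a. Qed.

Lemma ball_spinor_spinor_measurable h : ball_spinor h -> spinor_measurable h.
Proof.
move=> /ball_spinor_measurable[mr mi] a.
by split; [exact: measurable_funS (mr a)|exact: measurable_funS (mi a)].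
Qed.

Lemma spinor_measurableB f g : spinor_measurable f -> spinor_measurable g ->
  spinor_measurable (fun x => f x - g x).
Proof.
move=> mf mg a; have [rf imf] := mf a; have [rg img] := mg a.
split; [move: rf rg|move: imf img] => m1 m2; have := measurable_funB m1 m2;
  congr measurable_fun; apply/funext => x; rewrite /re_part /im_part !mxE.
  by rewrite /=; case: (f x a 0) => ? ?; case: (g x a 0).
by rewrite /=; case: (f x a 0) => ? ?; case: (g x a 0).
Qed.

Lemma ball_moment_ge0 s h : (0 <= ball_moment s h)%E.
Proof. by apply: integral_ge0 => x _; rewrite lee_fin powR_ge0. Qed.

Lemma spinor_norm0 : spinor_norm (0 : 'cV[R[i]]_4) = 0.
Proof. by rewrite /spinor_norm big1 ?sqrtr0// => a _; rewrite !mxE/= expr0n addr0. Qed.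

Lemma ball_momentT (s : R) h : 0 < s -> ball_spinor h ->
  (\int[leb3 R]_x (spinor_norm (h x) `^ s)%:E = ball_moment s h)%E.
Proof.
move=> s0 [_ h0]; rewrite /ball_moment [RHS]integral_mkcond.
apply: eq_integral => x _; rewrite patchE; case: ifPn => //.
by rewrite notin_setE => /h0 ->; rewrite spinor_norm0 powR0 ?gt_eqF.
Qed.

Lemma ball_moment_lty (s : R) h : 0 <= s -> ball_spinor h -> (ball_moment s h < +oo)%E.
Proof.
move=> s0 bh; have [C C0 HC] := ball_spinor_bounded bh.
have mh := spinor_norm_measurable (ball_spinor_spinor_measurable bh).
apply: (@le_lt_trans _ _ (\int[leb3 R]_(x in unit_ball R) (C `^ s)%:E)%E).
  apply: ge0_le_integral => //.
  - by move=> x _; rewrite lee_fin powR_ge0.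
  - exact: measurable_powR_norm.
  - by move=> x _; rewrite lee_fin ge0_ler_powR// nnegrE ?spinor_norm_ge0.
rewrite integral_cst//; apply: (@le_lt_trans _ _ ((C `^ s)%:E * 8%:E)%E).
  by apply: lee_wpmul2l; [rewrite lee_fin powR_ge0|exact: leb3_unit_ball].
by rewrite -EFinM ltry.
Qed.

Lemma ball_moment_le_sum (s : R) w u v : 0 <= s ->
  norm_measurable w -> norm_measurable u -> norm_measurable v ->
  (forall x, w x = u x + v x \/ w x = u x - v x) ->
  (ball_moment s w <= (2 `^ s)%:E * (ball_moment s u + ball_moment s v))%E.
Proof.
move=> s0 mw mu mv h.
rewrite /ball_moment -ge0_integralD//; first last.
- exact: measurable_powR_norm.
- by move=> x _; rewrite lee_fin powR_ge0.
- exact: measurable_powR_norm.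
- by move=> x _; rewrite lee_fin powR_ge0.
rewrite -ge0_integralZl_EFin ?powR_ge0//; first last.
- by apply: emeasurable_funD; exact: measurable_powR_norm.
- by move=> x _; rewrite adde_ge0// lee_fin powR_ge0.
apply: ge0_le_integral => //.
- by move=> x _; rewrite lee_fin powR_ge0.
- exact: measurable_powR_norm.
- apply: emeasurable_funM => //.
  by apply: emeasurable_funD; exact: measurable_powR_norm.
- by move=> x _; rewrite -EFinD -EFinM lee_fin; exact: powR_spinor_norm_le.
Qed.

(** [|h|^r] is at most [d^r] where [|h| <= d] and at most [d^(r-p) |h|^p] elsewhere; 8 bounds the
    volume of the ball. With [d] free, small [p]-th moments give small [r]-th moments. *)
Lemma ball_moment_interp (r p d : R) h : 0 <= r -> r <= p -> 0 < d -> norm_measurable h ->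
  (ball_moment r h <= (8 * d `^ r)%:E + (d `^ (r - p))%:E * ball_moment p h)%E.
Proof.
move=> r0 rp d0 mh.
apply: (@le_trans _ _ (\int[leb3 R]_(x in unit_ball R)
  ((d `^ r)%:E + (d `^ (r - p))%:E * (spinor_norm (h x) `^ p)%:E))%E).
  apply: ge0_le_integral => //.
  - by move=> x _; rewrite lee_fin powR_ge0.
  - exact: measurable_powR_norm.
  - apply: emeasurable_funD => //; apply: emeasurable_funM => //.
    exact: measurable_powR_norm.
  - move=> x _; rewrite -EFinM -EFinD lee_fin.
    have N0 := spinor_norm_ge0 (h x).
    have [le|lt] := leP (spinor_norm (h x)) d.
      rewrite (@le_trans _ _ (d `^ r))//; first by rewrite ge0_ler_powR ?nnegrE// ltW.
      by rewrite lerDl mulr_ge0// powR_ge0.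
    have Np := lt_trans d0 lt.
    rewrite (@le_trans _ _ (d `^ (r - p) * spinor_norm (h x) `^ p))//; last first.
      by rewrite lerDr powR_ge0.
    rewrite -[leLHS](_ : spinor_norm (h x) `^ (r - p) * spinor_norm (h x) `^ p = _); last first.
      by rewrite -powRD ?subrK// (gt_eqF Np) implybT.
    rewrite ler_wpM2r ?powR_ge0//.
    rewrite -(opprB p r) !powRN lef_pV2 ?posrE ?powR_gt0//.
    by rewrite ge0_ler_powR ?nnegrE ?subr_ge0// ltW.
rewrite ge0_integralD//; first last.
- by apply: emeasurable_funM => //; exact: measurable_powR_norm.
- by move=> x _; rewrite mule_ge0// lee_fin powR_ge0.
- by move=> x _; rewrite lee_fin powR_ge0.
rewrite integral_cst// ge0_integralZl_EFin ?powR_ge0//; first last.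
- exact: measurable_powR_norm.
- by move=> x _; rewrite lee_fin powR_ge0.
apply: leeD => //; rewrite [leRHS]EFinM muleC.
by apply: lee_wpmul2r; [rewrite lee_fin powR_ge0|exact: leb3_unit_ball].
Qed.

Lemma dirac_sobolev_approx (p : R) f g : 0 < p -> dirac_sobolev p f g ->
  forall e, 0 < e -> exists phi, [/\ test_function phi,
    (ball_moment p (fun x => phi x - f x)%R <= e%:E)%E &
    (ball_moment p (fun x => dirac_op phi x - g x)%R <= e%:E)%E].
Proof.
move=> p0 [mf mg [phi [tphi cphi]]] e e0.
have ep : 0 < e `^ p^-1 by exact: powR_gt0.
have /fine_cvgP[fin cv] := cphi.
have [n _ /(_ n (leqnn n)) [hfin hn]] := filterI fin (cvgr_lt 0 cv _ ep).
exists (phi n).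
have m1 : norm_measurable (fun x => phi n x - f x).
  apply: spinor_norm_measurable; apply: spinor_measurableB => //.
  exact: ball_spinor_spinor_measurable (test_ball_spinor (tphi n)).
have m2 : norm_measurable (fun x => dirac_op (phi n) x - g x).
  apply: spinor_norm_measurable; apply: spinor_measurableB => //.
  exact: ball_spinor_spinor_measurable (dirac_ball_spinor (tphi n)).
have {}hn : (graph_norm p (fun x => phi n x - f x)%R
    (fun x => dirac_op (phi n) x - g x)%R < (e `^ p^-1)%:E)%E.
  by rewrite -(fineK hfin) lte_fin.
pose X := (\int[leb3 R]_(x in unit_ball R) ((spinor_norm (dirac_op (phi n) x - g x)%R `^ p)%:E +
  (spinor_norm (phi n x - f x)%R `^ p)%:E))%E.
have Xe : (X <= e%:E)%E.
  rewrite leNgt; apply/negP => eX; move: hn; rewrite ltNge => /negP; apply.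
  rewrite /graph_norm -[X in (_ <= X `^ _)%E]/X -poweR_EFin.
  by apply: gt0_ler_poweR; rewrite ?invr_ge0 ?(ltW p0) ?in_itv/= ?lee_fin ?(ltW e0) ?(ltW eX) ?leey//;
    rewrite (le_trans _ (ltW eX))// lee_fin ltW.
have XD : X = (ball_moment p (fun x => dirac_op (phi n) x - g x)%R +
               ball_moment p (fun x => phi n x - f x)%R)%E.
  rewrite /X ge0_integralD//; first last.
  - exact: measurable_powR_norm.
  - by move=> x _; rewrite lee_fin powR_ge0.
  - exact: measurable_powR_norm.
  - by move=> x _; rewrite lee_fin powR_ge0.
rewrite XD in Xe; split => //; apply: le_trans Xe.
  by rewrite leeDr// ball_moment_ge0.
by rewrite leeDl// ball_moment_ge0.
Qed.

Lemma dirac_sobolev_moment_lty (p : R) f g : 0 < p -> dirac_sobolev p f g ->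
  (ball_moment p f < +oo)%E /\ (ball_moment p g < +oo)%E.
Proof.
move=> p0 fg; have [mf mg _] := fg.
have [phi [tphi h1 h2]] := dirac_sobolev_approx p0 fg ltr01.
have bphi := test_ball_spinor tphi; have bd := dirac_ball_spinor tphi.
have H (u w : R * R * R -> 'cV[R[i]]_4) : ball_spinor u -> spinor_measurable w ->
    (ball_moment p (fun x => u x - w x)%R <= 1%:E)%E -> (ball_moment p w < +oo)%E.
  move=> bu mw h; have mu := ball_spinor_spinor_measurable bu.
  have mB' := spinor_norm_measurable (spinor_measurableB mu mw).
  apply: le_lt_trans (ball_moment_le_sum (ltW p0) (spinor_norm_measurable mw)
    (spinor_norm_measurable mu) mB' _) _.
    by move=> x; right; rewrite opprB addrC subrK.
  apply: lte_mul_pinfty; rewrite ?lee_fin ?powR_ge0//.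
  rewrite lte_add_pinfty//; first exact: ball_moment_lty (ltW p0) bu.
  by rewrite (le_lt_trans h) ?ltry.
by split; [exact: H bphi mf h1|exact: H bd mg h2].
Qed.

End moments.

(** * Level sets in the Dirac-Sobolev space and summation over levels *)

Section interpolation.
Variable R : realType.
Implicit Types (f g h u v w : R * R * R -> 'cV[R[i]]_4).

Let mB := @measurable_unit_ball R.

(** The 16 and the divisors [3 * 24 * 16 ^+ 2] and [3 * 16 ^+ 3] of [lam] come from
    [test_weak_type]. *)
Definition weak_const (p q : R) : R :=
  16 * ((72 * 16 ^+ 2) `^ p * (3 * 16 ^+ 3) `^ (q - p)).

Lemma weak_const_ge0 p q : 0 <= weak_const p q.
Proof. by rewrite /weak_const !mulr_ge0 ?powR_ge0. Qed.

Lemma level_set_constant (p s al be lam ka kb rho : R) : 0 < al -> 0 < be -> 0 < lam ->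
  0 < ka -> 0 < kb -> 0 < rho -> rho `^ p = (be * ka / lam) `^ s ->
  (lam / kb / rho) `^ p * (16 * (kb `^ p * ka `^ s) * ((al / lam) `^ p * (be / lam) `^ s)) =
  16 * al `^ p.
Proof.
move=> al0 be0 lam0 ka0 kb0 rho0 rhop.
have D (x y t : R) : 0 < x -> 0 < y -> (x / y) `^ t = x `^ t / y `^ t.
  by move=> x0 y0; rewrite powRM ?invr_ge0 ?ltW// -powR_inv1 ?ltW// powRAC powR_inv1// powR_ge0.
have N (x t : R) : 0 < x -> x `^ t != 0 by move=> x0; rewrite gt_eqF// powR_gt0.
rewrite (D _ rho)// ?divr_gt0// rhop !D// ?mulr_gt0// (@powRM _ be ka) ?ltW//.
by field; rewrite !N.
Qed.

Lemma test_level_set phi (p q r al be lam : R) : test_function phi ->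
  1 <= p -> 1 <= r -> r = 3 * (q / p - 1) -> 0 < al -> 0 < be -> 0 < lam ->
  (ball_moment p (dirac_op phi) <= (al `^ p)%:E)%E ->
  (ball_moment r phi <= (be `^ r)%:E)%E ->
  (leb3 R [set x | (lam < spinor_norm (phi x))%R] <=
    (weak_const p q * ((al / lam) `^ p * (be / lam) `^ (q - p)))%:E)%E.
Proof.
move=> tphi p1 r1 hr al0 be0 lam0 hd hf.
have p0 : 0 < p by rewrite (lt_le_trans _ p1).
have r0 : 0 < r by rewrite (lt_le_trans _ r1).
pose ka : R := 3 * 16 ^+ 3; pose kb : R := 72 * 16 ^+ 2.
have ka0 : 0 < ka by rewrite mulr_gt0// exprn_gt0.
have kb0 : 0 < kb by rewrite mulr_gt0// exprn_gt0.
have x0 : 0 < be * ka / lam by rewrite divr_gt0// mulr_gt0.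
(* Chosen so that [rho ^+ 3 * (lam / ka)]^ r = be [^ r], which meets the moment hypothesis of
   [test_weak_type] with a factor 8 to spare. *)
pose rho := (be * ka / lam) `^ (r / 3).
have rho0 : 0 < rho by exact: powR_gt0.
have rho3 : rho ^+ 3 = (be * ka / lam) `^ r.
  by rewrite -powR_mulrn ?ltW// -powRrM divfK// pnatr_eq0.
have rhop : rho `^ p = (be * ka / lam) `^ (q - p).
  rewrite -powRrM; congr (_ `^ _); rewrite hr; field.
  by rewrite gt_eqF.
have := @test_weak_type R phi p r lam rho tphi p1 r1 rho0 lam0.
rewrite (ball_momentT r0 (test_ball_spinor tphi)).
rewrite (ball_momentT p0 (dirac_ball_spinor tphi)) => wt.
have {}wt := wt (le_trans hf _).
have E1 : lam / 3 / 16 ^+ 3 = lam / ka by rewrite -mulrA -invfM.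
have E2 : lam / 3 / (24 * 16 ^+ 2 * rho) = lam / kb / rho.
  rewrite -[LHS]mulrA -[RHS]mulrA -!invfM; congr (_ / _); rewrite /kb.
  by move: (16 ^+ 2) => t; ring.
rewrite E1 E2 rho3 in wt.
have {}wt : (((lam / kb / rho) `^ p)%:E * leb3 R [set x | (lam < spinor_norm (phi x))%R] <=
    16%:E * (al `^ p)%:E)%E.
  apply: le_trans (wt _) _; last by apply: lee_wpmul2l => //; rewrite lee_fin.
  rewrite lee_fin -mulrA -powRM ?(ltW x0) ?divr_ge0 ?(ltW lam0) ?(ltW ka0)//.
  rewrite (_ : be * ka / lam * (lam / ka) = be); last first.
    by field; rewrite !gt_eqF.
  by rewrite ler_peMl ?powR_ge0// ler1n.
have c0 : 0 < (lam / kb / rho) `^ p by rewrite powR_gt0// !divr_gt0.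
rewrite -(@lee_pmul2l _ ((lam / kb / rho) `^ p)%:E)// (le_trans wt)//.
rewrite -2!EFinM lee_fin le_eqVlt; apply/orP; left; apply/eqP.
by rewrite [weak_const _ _]/weak_const level_set_constant.
Qed.

Lemma measurable_level h (lam : R) : norm_measurable h ->
  measurable (unit_ball R `&` [set x | (lam < spinor_norm (h x))%R] : set (borel3 R)).
Proof.
move=> mh; have := mh mB _ (measurable_itv `]lam, +oo[).
by congr measurable; apply/seteqP; split => z /=; rewrite in_itv/= andbT.
Qed.

Lemma chebyshev_level h (p lam : R) : 0 < p -> 0 < lam -> norm_measurable h ->
  ((lam `^ p)%:E * leb3 R (unit_ball R `&` [set x | (lam < spinor_norm (h x))%R]) <=
    ball_moment p h)%E.
Proof.
move=> p0 lam0 mh.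
have lp : 0 < lam `^ p by exact: powR_gt0.
have := @le_integral_abse _ _ _ (leb3 R) _ mB _ _ (measurable_powR_norm p mh) lp.
rewrite (_ : (\int[_]_(x in _) _)%E = ball_moment p h); last first.
  by apply: eq_integral => x _; rewrite gee0_abs// lee_fin powR_ge0.
apply: le_trans; apply: lee_wpmul2l; first by rewrite lee_fin powR_ge0.
apply: le_measure; rewrite ?inE.
- exact: measurable_level.
- apply: emeasurable_fun_c_infty => //; apply: measurableT_comp => //.
  exact: measurable_powR_norm.
move=> x /= [Bx lx]; split => //.
rewrite ger0_norm ?powR_ge0// lee_fin.
by rewrite ge0_ler_powR ?nnegrE ?spinor_norm_ge0// ltW.
Qed.

Lemma ge0_lt_EFin (x : \bar R) (y : R) :
  (0 <= x)%E -> (x < y%:E)%E -> exists2 a, x = a%:E & a < y.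
Proof. by case: x => // a _; rewrite lte_fin => ay; exists a. Qed.

(** Where [|f| > 2 lam], either [|phi| > lam] or [|phi - f| > lam]. The first set is controlled by
    [test_level_set] with [al] and [be] doubled, the price of the quasi-triangle inequality; by
    Chebyshev the second has arbitrarily small measure. *)
Lemma sobolev_level_set f g (p q r al be lam : R) : dirac_sobolev p f g ->
  1 <= p -> 1 <= r -> r <= p -> r = 3 * (q / p - 1) -> 0 < al -> 0 < be -> 0 < lam ->
  (ball_moment p g < (al `^ p)%:E)%E -> (ball_moment r f < (be `^ r)%:E)%E ->
  (leb3 R (unit_ball R `&` [set x | (2 * lam < spinor_norm (f x))%R]) <=
    (weak_const p q * ((2 * al / lam) `^ p * (2 * be / lam) `^ (q - p)))%:E)%E.
Proof.
move=> fg p1 r1 rp hr al0 be0 lam0 ga fb; have [mf mg _] := fg.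
have p0 : 0 < p by rewrite (lt_le_trans _ p1).
have r0 : 0 < r by rewrite (lt_le_trans _ r1).
have [a aE aal] := ge0_lt_EFin (ball_moment_ge0 p g) ga.
have [b bE bbe] := ge0_lt_EFin (ball_moment_ge0 r f) fb.
clear ga fb.
apply/lee_addgt0Pr => e e0.
(* [8 * d]^ r[is half of the margin]be [^ r - b]. In [e1] below, the second entry keeps the other
   term of [ball_moment_interp] within the other half, the first protects the margin of [al], and
   the third feeds Chebyshev. *)
pose d := ((be `^ r - b) / 16) `^ r^-1.
have bb0 : 0 < (be `^ r - b) / 16 by rewrite divr_gt0// subr_gt0.
have d0 : 0 < d by exact: powR_gt0.
have dr : d `^ r = (be `^ r - b) / 16.
  by rewrite /d -powRrM mulVf ?gt_eqF// powRr1 ?ltW.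
have drp : 0 < d `^ (r - p) by exact: powR_gt0.
pose e1 := Num.min (al `^ p - a)
  (Num.min ((be `^ r - b) / 2 / d `^ (r - p)) (e * lam `^ p)).
have e1a : e1 <= al `^ p - a by rewrite /e1 ge_min lexx.
have e1b : e1 <= (be `^ r - b) / 2 / d `^ (r - p) by rewrite /e1 !ge_min lexx orbT.
have e1e : e1 <= e * lam `^ p by rewrite /e1 !ge_min lexx !orbT.
have e10 : 0 < e1.
  rewrite /e1 !lt_min subr_gt0 aal !divr_gt0// ?subr_gt0//.
  by rewrite mulr_gt0// powR_gt0.
clearbody d e1.
have [phi [tphi hf hg]] := dirac_sobolev_approx p0 fg e10.
have mphi := ball_spinor_spinor_measurable (test_ball_spinor tphi).
have mdphi := ball_spinor_spinor_measurable (dirac_ball_spinor tphi).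
have nf := spinor_norm_measurable mf; have ng := spinor_norm_measurable mg.
have nphi := spinor_norm_measurable mphi.
have ndphi := spinor_norm_measurable mdphi.
have nBf := spinor_norm_measurable (spinor_measurableB mphi mf).
have nBg := spinor_norm_measurable (spinor_measurableB mdphi mg).
have H1 : (ball_moment p (dirac_op phi) <= ((2 * al) `^ p)%:E)%E.
  apply: le_trans (ball_moment_le_sum (ltW p0) ndphi nBg ng _) _.
    by move=> x; left; rewrite subrK.
  rewrite powRM ?(ltW al0)// [leRHS]EFinM; apply: lee_wpmul2l.
    by rewrite lee_fin powR_ge0.
  apply: le_trans (leeD hg (le_refl _)) _.
  by rewrite aE -EFinD lee_fin -lerBrDr.
have H2 : (ball_moment r phi <= ((2 * be) `^ r)%:E)%E.
  apply: le_trans (ball_moment_le_sum (ltW r0) nphi nBf nf _) _.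
    by move=> x; left; rewrite subrK.
  rewrite powRM ?(ltW be0)// [leRHS]EFinM; apply: lee_wpmul2l.
    by rewrite lee_fin powR_ge0.
  apply: le_trans (leeD (ball_moment_interp (ltW r0) rp d0 nBf) (le_refl _)) _.
  rewrite dr.
  apply: (@le_trans _ _ ((8 * ((be `^ r - b) / 16))%:E + (d `^ (r - p))%:E * e1%:E +
      ball_moment r f)%E).
    apply: leeD; last exact: le_refl.
    apply: leeD; first exact: le_refl.
    by apply: lee_wpmul2l hf; rewrite lee_fin ltW.
  rewrite bE -EFinM -!EFinD lee_fin.
  have : d `^ (r - p) * e1 <= (be `^ r - b) / 2.
    by rewrite mulrC -ler_pdivlMr.
  by lra.
have al2 (x : R) : 0 < x -> 0 < 2 * x by move=> x0; rewrite mulr_gt0.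
have L := test_level_set tphi p1 r1 hr (al2 al al0) (al2 be be0) lam0 H1 H2.
have Lf : (leb3 R (unit_ball R `&` [set x | (lam < spinor_norm (phi x - f x))%R]) <= e%:E)%E.
  have lp : 0 < lam `^ p by exact: powR_gt0.
  rewrite -(@lee_pmul2l _ (lam `^ p)%:E)//.
  apply: le_trans (chebyshev_level p0 lam0 nBf) _.
  by apply: le_trans hf _; rewrite -EFinM lee_fin mulrC.
apply: le_trans _ (leeD L Lf).
have mA := measurable_level lam nphi; have mA' := measurable_level lam nBf.
apply: (@le_trans _ _ (leb3 R ((unit_ball R `&` [set x | (lam < spinor_norm (phi x))%R]) `|`
  (unit_ball R `&` [set x | (lam < spinor_norm (phi x - f x))%R])))).
  apply: le_measure; rewrite ?inE.
  - exact: measurable_level.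
  - exact: measurableU.
  move=> x /= [Bx hx].
  have /spinor_norm_le_max : f x = phi x + (phi x - f x) \/ f x = phi x - (phi x - f x).
    by right; rewrite opprB addrC subrK.
  move=> /(lt_le_trans hx); rewrite ltr_pM2l// lt_max => /orP[]; first by left.
  by right.
apply: le_trans (measureU2 _ _ _) _ => //.
apply: leeD => //.
have -> : [set x | (lam < spinor_norm (phi x))%R] =
    unit_ball R `&` [set x | (lam < spinor_norm (phi x))%R].
  apply/seteqP; split => [x /= hx|x [_ hx]//]; split => //.
  apply: contrapT => nB; move: hx; have [_ ->//] := test_ball_spinor tphi.
  by rewrite spinor_norm0 ltNge ltW.
by rewrite setIA setIid.
Qed.

Lemma dyadic_above (L t : R) : 0 < L -> L < t ->
  exists n, L * 2 ^+ n < t <= L * 2 ^+ n.+1.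
Proof.
move=> L0 Lt; have ex : exists n, t <= L * 2 ^+ n.
  exists (Num.truncn (t / L)).+1; rewrite mulrC -ler_pdivrMr//.
  by rewrite (le_trans (ltW (truncnS_gt _)))// -natrX ler_nat ltnW// ltn_expl.
case: (ex_minnP ex) => -[|n]; first by rewrite expr0 mulr1 leNgt Lt.
move=> h hmin; exists n; rewrite h andbT ltNge; apply/negP => /hmin.
by rewrite ltnn.
Qed.

Lemma powR2B_lt1 (k q : R) : k < q -> 2 `^ (k - q) < 1 :> R.
Proof.
move=> kq; rewrite -(opprB q k) powRN invf_lt1 ?powR_gt0//.
rewrite -[ltLHS](_ : 1 `^ (q - k) = 1); last by rewrite powR1.
by apply: gt0_ltr_powR; rewrite ?subr_gt0 ?nnegrE// ltr1n.
Qed.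

Lemma exprn_powRB (b s t : R) n : 0 < b ->
  (b `^ (s - t)) ^+ n = (b ^+ n) `^ s * ((b ^+ n)^-1) `^ t.
Proof.
move=> b0; have t0 : 0 < b ^+ n by exact: exprn_gt0.
rewrite -(powR_inv1 (ltW t0)) -powRrM -powRD ?(gt_eqF t0) ?implybT// mulN1r.
rewrite -(powR_mulrn n (powR_ge0 b (s - t))) -(powR_mulrn n (ltW b0)).
by rewrite -(powRrM b) -(powRrM b) mulrC.
Qed.

Lemma sum_geometric_le (z : R) n : 0 <= z -> z < 1 ->
  \sum_(0 <= i < n) z ^+ i <= (1 - z)^-1.
Proof.
move=> z0 z1; rewrite big_mkord -[leRHS]mul1r ler_pdivlMr ?subr_gt0// mulrC.
by rewrite -opprB mulNr -subrX1 opprB lerBlDr lerDl exprn_ge0.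
Qed.

(** Where [|h| <= L], the volume of the ball suffices. Above, the level [L 2^n] contributes at most
    [(L 2^(n+1))^k C 2^(-n q)], a geometric series of ratio [2^(k-q) < 1]. *)
Lemma layer_cake h (q k L C : R) : norm_measurable h -> 0 < k -> k < q -> 0 < L -> 0 <= C ->
  (forall t, 0 < t -> (leb3 R (unit_ball R `&` [set x | (t < spinor_norm (h x))%R]) <=
     (C * (L / t) `^ q)%:E)%E) ->
  (ball_moment k h <= ((8 + C * 2 `^ k / (1 - 2 `^ (k - q))) * L `^ k)%:E)%E.
Proof.
move=> mh k0 kq L0 C0 hC.
pose A n : set (borel3 R) := unit_ball R `&` [set x | (L * 2 ^+ n < spinor_norm (h x))%R].
have mA n : measurable (A n) by exact: measurable_level.
pose T n (x : borel3 R) : \bar R := ((L * 2 ^+ n.+1) `^ k * \1_(A n) x)%:E.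
have T0 n x : (0 <= T n x)%E by rewrite lee_fin mulr_ge0// ?powR_ge0// indicE.
have mT n : measurable_fun (unit_ball R : set (borel3 R)) (T n).
  by apply/measurable_EFinP; apply: measurable_funM.
have z0 : 0 < 2 `^ (k - q) :> R by exact: powR_gt0.
have z1 := powR2B_lt1 kq.
pose z : R := 2 `^ (k - q).
have intT n : (\int[leb3 R]_(x in unit_ball R) T n x <= (C * 2 `^ k * L `^ k * z ^+ n)%:E)%E.
  rewrite /T; under eq_integral do rewrite EFinM.
  rewrite ge0_integralZl_EFin ?powR_ge0//; last exact/measurable_EFinP.
  rewrite integral_indic// -setIA [X in (_ `&` X)%classic]setIC setIA setIid.
  apply: le_trans (lee_wpmul2l _ (hC _ _)) _.
  - by rewrite lee_fin powR_ge0.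
  - by rewrite mulr_gt0// exprn_gt0.
  rewrite -EFinM lee_fin le_eqVlt; apply/orP; left; apply/eqP.
  have t0 : 0 < 2 ^+ n :> R by rewrite exprn_gt0.
  rewrite (_ : L * 2 ^+ n.+1 = 2 * L * 2 ^+ n); last by rewrite exprS; ring.
  rewrite (_ : L / (L * 2 ^+ n) = (2 ^+ n)^-1); last by field; rewrite !gt_eqF.
  rewrite (@powRM _ (2 * L)) ?mulr_ge0 ?(ltW L0) ?(ltW t0)// (@powRM _ 2) ?(ltW L0)//.
  by rewrite /z exprn_powRB//; ring.
have intS : (\int[leb3 R]_(x in unit_ball R) (\sum_(n <oo) T n x) <=
    (C * 2 `^ k * L `^ k / (1 - z))%:E)%E.
  rewrite integral_nneseries//.
  apply: lime_le; first by apply: is_cvg_nneseries => n _ _; apply: integral_ge0 => x _.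
  apply: nearW => n; apply: (@le_trans _ _ (\sum_(0 <= i < n) (C * 2 `^ k * L `^ k * z ^+ i)%:E)%E).
    by apply: lee_sum => i _.
  rewrite sumEFin lee_fin -mulr_sumr ler_wpM2l ?mulr_ge0 ?powR_ge0//.
  by apply: sum_geometric_le; rewrite ?(ltW z0).
apply: (@le_trans _ _ (\int[leb3 R]_(x in unit_ball R) ((L `^ k)%:E + \sum_(n <oo) T n x))%E).
  apply: ge0_le_integral => //.
  - by move=> x _; rewrite lee_fin powR_ge0.
  - exact: measurable_powR_norm.
  - apply: emeasurable_funD => //.
    by apply: ge0_emeasurable_sum => [n x _ _|n _]; [exact: T0|exact: mT].
  move=> x Bx; have [le|lt] := leP (spinor_norm (h x)) L.
    rewrite -[leLHS]adde0; apply: leeD; last by apply: nneseries_ge0.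
    by rewrite lee_fin ge0_ler_powR ?nnegrE ?spinor_norm_ge0// ltW.
  have [n /andP[n1 n2]] := dyadic_above L0 lt.
  rewrite -[leLHS]add0e; apply: leeD; first by rewrite lee_fin powR_ge0.
  rewrite (@nneseriesD1 _ _ n xpredT)//.
  rewrite -[leLHS]adde0; apply: leeD; last by apply: nneseries_ge0.
  rewrite /T indicE mem_set//.
  rewrite mulr1 lee_fin ge0_ler_powR ?nnegrE ?spinor_norm_ge0 ?mulr_ge0 ?exprn_ge0 ?(ltW L0)//.
  exact: ltW.
rewrite ge0_integralD//; first last.
- by apply: ge0_emeasurable_sum => [n x _ _|n _]; [exact: T0|exact: mT].
- by move=> x _; apply: nneseries_ge0.
- by move=> x _; rewrite lee_fin powR_ge0.
rewrite integral_cst// mulrDl EFinD; apply: leeD.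
  rewrite [leRHS]EFinM muleC.
  by apply: lee_wpmul2r; [rewrite lee_fin powR_ge0|exact: leb3_unit_ball].
apply: le_trans intS _; rewrite lee_fin /z.
by rewrite le_eqVlt; apply/orP; left; apply/eqP; rewrite mulrAC.
Qed.

(** Recognizes the bound of [sobolev_level_set] at level [t / 2] as the [q]-th power of [L / t]; the
    4 combines the doubled [al], [be] with the halved level. *)
Lemma level_set_scaling (p q al be t : R) : 0 < al -> 0 < be -> 0 < t -> 0 < q ->
  (2 * al / (t / 2)) `^ p * (2 * be / (t / 2)) `^ (q - p) =
  4 `^ q * (al `^ (p / q) * be `^ (1 - p / q) / t) `^ q.
Proof.
move=> al0 be0 t0 q0; have qn : q != 0 by rewrite gt_eqF.
have P (x : R) : 2 * x / (t / 2) = 4 * (x / t) by field; rewrite gt_eqF.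
have [x0 y0] : 0 < al / t /\ 0 < be / t by rewrite !divr_gt0.
have -> : al `^ (p / q) * be `^ (1 - p / q) / t =
    (al / t) `^ (p / q) * (be / t) `^ (1 - p / q).
  have E : t^-1 = t^-1 `^ (p / q) * t^-1 `^ (1 - p / q).
    rewrite -powRD ?invr_eq0 ?(gt_eqF t0) ?implybT// addrCA subrr addr0.
    by rewrite powRr1 ?invr_ge0 ?ltW.
  rewrite [X in _ * _ * X]E (@powRM _ al) ?invr_ge0 ?(ltW al0) ?(ltW t0)//.
  by rewrite (@powRM _ be) ?invr_ge0 ?(ltW be0) ?(ltW t0)// mulrACA.
rewrite !P !(@powRM _ 4) ?ltW// (@powRM _ ((al / t) `^ _)) ?powR_ge0//.
rewrite -!powRrM mulrBl mul1r divfK// mulrACA; congr (_ * _).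
by rewrite -powRD ?pnatr_eq0 ?implybT// addrC subrK.
Qed.

Lemma ball_norm_bound (p q r k : R) : 1 <= p -> p < q -> r = 3 * (q / p - 1) ->
  1 <= r -> r <= p -> 0 < k -> k < q ->
  exists2 K : R, 0 < K & forall f g al be, dirac_sobolev p f g -> 0 < al -> 0 < be ->
    (ball_moment p g < (al `^ p)%:E)%E -> (ball_moment r f < (be `^ r)%:E)%E ->
    (ball_norm k f <= (K * (al `^ (p / q) * be `^ (1 - p / q)))%:E)%E.
Proof.
move=> p1 pq hr r1 rp k0 kq.
have p0 : 0 < p by rewrite (lt_le_trans _ p1).
have q0 : 0 < q by exact: lt_trans pq.
pose C := weak_const p q * 4 `^ q.
have C0 : 0 <= C by rewrite mulr_ge0 ?weak_const_ge0 ?powR_ge0.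
pose M := 8 + C * 2 `^ k / (1 - 2 `^ (k - q)).
have z1 := powR2B_lt1 kq.
have M0 : 0 < M.
  by rewrite ltr_wpDr// divr_ge0 ?subr_ge0 ?(ltW z1)// mulr_ge0// powR_ge0.
exists (M `^ k^-1); first exact: powR_gt0.
move=> f g al be fg al0 be0 ha hb.
set L := al `^ (p / q) * be `^ (1 - p / q); have L0 : 0 < L by rewrite mulr_gt0// powR_gt0.
have nf : norm_measurable f by apply: spinor_norm_measurable; case: fg.
have H : (ball_moment k f <= (M * L `^ k)%:E)%E.
  apply: (layer_cake nf k0 kq L0 C0) => t t0.
  have t20 : 0 < t / 2 by rewrite divr_gt0.
  have := sobolev_level_set fg p1 r1 rp hr al0 be0 t20 ha hb.
  rewrite mulrC divfK ?pnatr_eq0// => /le_trans; apply.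
  by rewrite lee_fin level_set_scaling// mulrA.
have ML0 : 0 <= M * L `^ k by rewrite mulr_ge0 ?(ltW M0)// powR_ge0.
rewrite [leLHS](_ : _ = ball_moment k f `^ k^-1)%E//.
apply: (@le_trans _ _ ((M * L `^ k)%:E `^ k^-1)%E).
  apply: gt0_ler_poweR H; first by rewrite invr_ge0 ltW.
    by rewrite in_itv/= ball_moment_ge0 leey.
  by rewrite in_itv/= lee_fin ML0 leey.
rewrite poweR_EFin lee_fin powRM ?(ltW M0) ?powR_ge0// -powRrM mulfV ?gt_eqF//.
by rewrite powRr1// ltW.
Qed.

Lemma ball_moment_exponent_lty (r p : R) h : 0 <= r -> r <= p -> norm_measurable h ->
  (ball_moment p h < +oo)%E -> (ball_moment r h < +oo)%E.
Proof.
move=> r0 rp mh hp; apply: le_lt_trans (ball_moment_interp r0 rp ltr01 mh) _.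
apply: lte_add_pinfty; first exact: ltry.
by apply: lte_mul_pinfty; rewrite ?lee_fin ?powR_ge0.
Qed.

Lemma ball_norm_fin (s : R) h : 0 < s -> (ball_moment s h < +oo)%E ->
  exists A : R, [/\ 0 <= A, ball_norm s h = A%:E &
    forall al, A < al -> (ball_moment s h < (al `^ s)%:E)%E].
Proof.
move=> s0 hoo; have [a aE a0] : exists2 a, ball_moment s h = a%:E & 0 <= a.
  move: (ball_moment_ge0 s h) hoo; case: (ball_moment s h) => // a.
  by rewrite lee_fin; exists a.
exists (a `^ s^-1); split; first exact: powR_ge0.
  by rewrite -poweR_EFin -aE.
move=> al aal; rewrite aE lte_fin -[ltLHS](_ : (a `^ s^-1) `^ s = a).
  by apply: gt0_ltr_powR; rewrite ?nnegrE ?powR_ge0// ltW// (le_lt_trans _ aal)// powR_ge0.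
by rewrite -powRrM mulVf ?gt_eqF// powRr1.
Qed.

End interpolation.

Theorem corollary1 (R : realType) (p q r k theta : R)
    (hp : 1 <= p) (hpq : p < q)
    (hr : r = 3 * (q / p - 1)) (hr1 : 1 <= r) (hrp : r <= p)
    (hk0 : 0 < k) (hkq : k < q)
    (htheta : theta = p / q) :
  exists C : R, 0 < C /\
    forall f g : R * R * R -> 'cV[R[i]%C]_4,
      dirac_sobolev p f g ->
      (ball_norm k f <=
         C%:E * (ball_norm p g `^ theta * ball_norm r f `^ (1 - theta)))%E.
Proof.
have [K K0 HK] := ball_norm_bound hp hpq hr hr1 hrp hk0 hkq.
rewrite -htheta in HK.
have p0 : 0 < p by rewrite (lt_le_trans _ hp).
have r0 : 0 < r by rewrite (lt_le_trans _ hr1).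
have q0 : 0 < q by exact: lt_trans hpq.
have th0 : 0 < theta by rewrite htheta divr_gt0.
have th1 : 0 < 1 - theta by rewrite subr_gt0 htheta ltr_pdivrMr// mul1r.
(* When both norms are positive, they are doubled to obtain strict bounds, at the cost of
   [2^theta 2^(1-theta) = 2]. *)
exists (K * 2); split; first by rewrite mulr_gt0.
move=> f g fg; have [pf pg] := dirac_sobolev_moment_lty p0 fg.
have nf : norm_measurable f by apply: spinor_norm_measurable; case: fg.
have rf := ball_moment_exponent_lty (ltW r0) hrp nf pf.
have [A [A0 EA HA]] := ball_norm_fin p0 pg.
have [B [B0 EB HB]] := ball_norm_fin r0 rf.
rewrite EA EB (poweR_EFin A) (poweR_EFin B).
rewrite -(EFinM (A `^ theta)) -(EFinM (K * 2)).
have {}HK al be : A < al -> B < be ->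
    (ball_norm k f <= (K * (al `^ theta * be `^ (1 - theta)))%:E)%E.
  move=> Aal Bbe; apply: HK (HA _ Aal) (HB _ Bbe) => //.
    exact: le_lt_trans Aal.
  exact: le_lt_trans Bbe.
have [/andP[Ap Bp]|] := boolP ((0 < A) && (0 < B)).
  apply: le_trans (HK (2 * A) (2 * B) _ _) _; rewrite ?ltr_pMl ?ltr1n//.
  rewrite lee_fin !(@powRM _ 2)// mulrACA -powRD ?pnatr_eq0 ?implybT//.
  by rewrite addrCA subrr addr0 powRr1// (mulrA K 2).
rewrite negb_and -!leNgt => AB0.
(* Both exponents must be nonzero here, since a zero base to the power 0 is 1. *)
have -> : A `^ theta * B `^ (1 - theta) = 0.
  case/orP: AB0 => h; [have -> : A = 0|have -> : B = 0]; try by apply/le_anti/andP.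
    by rewrite powR0 ?gt_eqF// mul0r.
  by rewrite powR0 ?gt_eqF// mulr0.
rewrite mulr0; apply/lee_addgt0Pr => e e0; rewrite add0e.
(* With the other bound frozen at norm plus one, the bound on the vanishing norm is chosen so that
   the product is exactly [e / K]; the left side is then at most [e]. *)
have E (x y s : R) : 0 < x -> 0 < y -> 0 < s ->
    (e / K / x `^ y) `^ s^-1 `^ s * x `^ y = e / K.
  move=> x0 y0 s0; rewrite -powRrM mulVf ?gt_eqF// powRr1; first last.
    by rewrite !divr_ge0 ?powR_ge0 ?ltW.
  by rewrite divfK// gt_eqF// powR_gt0.
have P (x y s : R) : 0 < x -> 0 < (e / K / x `^ y) `^ s^-1.
  by move=> x0; rewrite powR_gt0// !divr_gt0// powR_gt0.
have KE : K * (e / K) = e by rewrite mulrC divfK// gt_eqF.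
case/orP: AB0 => h.
  have B10 : 0 < B + 1 by rewrite ltr_wpDl.
  apply: le_trans (HK ((e / K / (B + 1) `^ (1 - theta)) `^ theta^-1) (B + 1) _ _) _.
  - by rewrite (le_lt_trans h)// P.
  - by rewrite ltrDl.
  - by rewrite E// KE.
have A10 : 0 < A + 1 by rewrite ltr_wpDl.
apply: le_trans (HK (A + 1) ((e / K / (A + 1) `^ theta) `^ (1 - theta)^-1) _ _) _.
- by rewrite ltrDl.
- by rewrite (le_lt_trans h)// P.
- by rewrite [X in K * X]mulrC E// KE.
Qed.
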